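(* For all positive integers $c_1<c_2$, the family of A2 tilings is not $(c_1,c_2)$-robust.
   Context: **Tiles.** Let $\psi=\sqrt{(\sqrt5-1)/2}$, so $\psi^4+\psi^2=1$. Let $B$ be the closed hexagonal region with consecutive vertices $(0,0),(\psi,0),(\psi,\psi^2),(\psi^3,\psi^2),(\psi^3,1),(0,1)$. A tile (Golden Bee) of size $d>0$ is any set $f(B)$, where $f$ is a similarity of the plane (orientation-reversing ones allowed) with ratio $d$; its longest side has length $d$. Since $B$ has no nontrivial symmetry, $f$ is determined by the tile. **Tilings.** Large $d$-tiles are tiles of size $d$, small $d$-tiles are tiles of size $\psi d$; a $d$-tile is a large or small $d$-tile. A $d$-tiling is a non-empty set of $d$-tiles with pairwise disjoint interiors; a tiling is a $d$-tiling for some $d$. It is a tiling of (it tiles) the union of its tiles. **Arrow rule.** Boundaries of $d$-tiles are divided into directed segments with colors in $\{3,4,5,6\}$ (color $i$ has length $d\psi^i$). Below, $P\to Q: i$ means the segment directed from $P$ to $Q$ with color $i$, given for $B$ and carried to the tile $f(B)$ by $f$. Large $d$-tile ($f$ of ratio $d$): $(0,0)\to(0,\psi^4):4$; $(0,2\psi^4)\to(0,\psi^4):4$; $(0,1)\to(0,2\psi^4):6$; $(\psi,0)\to(\psi^3,0):5$; $(\psi^3,0)\to(0,0):3$; $(\psi,\psi^2)\to(\psi,\psi^4):6$; $(\psi,\psi^4)\to(\psi,0):4$; $(\psi^3,\psi^2)\to(\psi,\psi^2):5$; $(\psi^3,1)\to(\psi^3,\psi^2):4$; $(0,1)\to(\psi^3,1):3$.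 Small $d$-tile ($f$ of ratio $d\psi$): $(0,0)\to(0,\psi^4):5$; $(0,\psi^4)\to(0,1):3$; $(\psi,0)\to(\psi^3,0):6$; $(\psi^3,0)\to(0,0):4$; $(\psi,0)\to(\psi,\psi^2):3$; $(\psi^3,\psi^2)\to(\psi,\psi^2):6$; $(\psi^3,1)\to(\psi^3,\psi^2):5$; $(0,1)\to(\psi^3,1):4$. A $d$-tiling satisfies the Arrow rule if, whenever a segment $e$ of one tile and a segment $e'$ of another tile have more than one common point, they coincide as segments and have the same color and the same direction. An A2 tiling is a tiling (of an arbitrary part of the plane) that satisfies the Arrow rule. **Robustness.** Let $c_1<c_2$ be positive integers. A family of tilings $\mathcal T$ is $(c_1,c_2)$-robust if for every positive natural number $\Delta$ and for every tiling $T\in\mathcal T$ that tiles a set $$S\supset([-c_2\Delta,c_2\Delta]\times[-c_2\Delta,c_2\Delta])\setminus([-\Delta,\Delta]\times[-\Delta,\Delta])$$ there exists a tiling $T'\in\mathcal T$ of the set $S\cup([-\Delta,\Delta]\times[-\Delta,\Delta])$ that contains all tiles from $T$ lying outside of the square $[-c_1\Delta,c_1\Delta]\times[-c_1\Delta,c_1\Delta]$. *)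

(* Defs.v *)
From mathcomp Require Import all_boot all_order all_algebra.
From mathcomp Require Import all_classical all_reals all_analysis.

Set Implicit Arguments.
Unset Strict Implicit.
Unset Printing Implicit Defensive.

Import Order.TTheory GRing.Theory Num.Theory.
Import numFieldNormedType.Exports.

Local Open Scope classical_set_scope.
Local Open Scope ring_scope.

Notation plane R := (R * R)%type.

Section GoldenBee.
Variable R : realType.

Definition psi : R := Num.sqrt ((Num.sqrt 5 - 1) / 2).

(* The library norm on a product is the max norm, hence this definition. *)
Definition dist2 (p q : plane R) : R :=
  Num.sqrt ((p.1 - q.1) ^+ 2 + (p.2 - q.2) ^+ 2).

(* Orientation-preserving and orientation-reversing maps alike. *)
Definition similarity (d : R) (f : plane R -> plane R) : Prop :=
  0 < d /\ forall p q, dist2 (f p) (f q) = d * dist2 p q.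

Definition segment (P Q : plane R) : set (plane R) :=
  [set P + t *: (Q - P) | t in `[0, 1]].

(* The L-shaped hexagon with consecutive vertices (0,0), (psi,0),
   (psi,psi^2), (psi^3,psi^2), (psi^3,1), (0,1); note psi^3 < psi and
   psi^2 < 1, and that its only reflex vertex is (psi^3,psi^2). *)
Definition bee : set (plane R) :=
  (`[0, psi] `*` `[0, psi ^+ 2]) `|` (`[0, psi ^+ 3] `*` `[0, 1]).

Definition is_tile (d : R) (A : set (plane R)) : Prop :=
  exists2 f, similarity d f & A = f @` bee.

Definition large_tile (d : R) (A : set (plane R)) : Prop := is_tile d A.
Definition small_tile (d : R) (A : set (plane R)) : Prop := is_tile (psi * d) A.

Definition d_tiling (d : R) (T : set (set (plane R))) : Prop :=
  [/\ 0 < d, T !=set0,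
      forall A, T A -> large_tile d A \/ small_tile d A
    & trivIset T (@interior (plane R))].

(* (P, Q, i) is the segment directed from P to Q with color i. *)
Definition arrow : Type := (plane R * plane R * nat)%type.

Definition large_arrows : seq arrow :=
  [:: ((0, 0), (0, psi ^+ 4), 4%N);
      ((0, 2 * psi ^+ 4), (0, psi ^+ 4), 4%N);
      ((0, 1), (0, 2 * psi ^+ 4), 6%N);
      ((psi, 0), (psi ^+ 3, 0), 5%N);
      ((psi ^+ 3, 0), (0, 0), 3%N);
      ((psi, psi ^+ 2), (psi, psi ^+ 4), 6%N);
      ((psi, psi ^+ 4), (psi, 0), 4%N);
      ((psi ^+ 3, psi ^+ 2), (psi, psi ^+ 2), 5%N);
      ((psi ^+ 3, 1), (psi ^+ 3, psi ^+ 2), 4%N);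
      ((0, 1), (psi ^+ 3, 1), 3%N)].

Definition small_arrows : seq arrow :=
  [:: ((0, 0), (0, psi ^+ 4), 5%N);
      ((0, psi ^+ 4), (0, 1), 3%N);
      ((psi, 0), (psi ^+ 3, 0), 6%N);
      ((psi ^+ 3, 0), (0, 0), 4%N);
      ((psi, 0), (psi, psi ^+ 2), 3%N);
      ((psi ^+ 3, psi ^+ 2), (psi, psi ^+ 2), 6%N);
      ((psi ^+ 3, 1), (psi ^+ 3, psi ^+ 2), 5%N);
      ((0, 1), (psi ^+ 3, 1), 4%N)].

Definition map_arrow (f : plane R -> plane R) (e : arrow) : arrow :=
  (f e.1.1, f e.1.2, e.2).

(* The similarity f is determined by A, as the bee has no symmetry; a large
   and a small d-tile are never equal, as their sizes differ. *)
Definition tile_arrow (d : R) (A : set (plane R)) (e : arrow) : Prop :=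
  (exists f, [/\ similarity d f, A = f @` bee
               & e \in map (map_arrow f) large_arrows]) \/
  (exists f, [/\ similarity (psi * d) f, A = f @` bee
               & e \in map (map_arrow f) small_arrows]).

(* Equality of arrows is coincidence as segments, with the same direction and
   the same color. *)
Definition arrow_rule (d : R) (T : set (set (plane R))) : Prop :=
  forall A A', T A -> T A' -> A <> A' ->
  forall e e', tile_arrow d A e -> tile_arrow d A' e' ->
  (exists x y, [/\ x <> y,
     (segment e.1.1 e.1.2 `&` segment e'.1.1 e'.1.2) x
   & (segment e.1.1 e.1.2 `&` segment e'.1.1 e'.1.2) y]) ->
  e = e'.

Definition A2_tiling (T : set (set (plane R))) : Prop :=
  exists d, d_tiling d T /\ arrow_rule d T.

Definition tiles (T : set (set (plane R))) (S : set (plane R)) : Prop :=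
  \bigcup_(A in T) A = S.

(* The square [-n, n] x [-n, n]. *)
Definition square (n : nat) : set (plane R) :=
  `[- n%:R, n%:R] `*` `[- n%:R, n%:R].

Definition robust (c1 c2 : nat) (F : set (set (set (plane R)))) : Prop :=
  forall Delta : nat, (0 < Delta)%N ->
  forall T S, F T -> tiles T S ->
  square (c2 * Delta) `\` square Delta `<=` S ->
  exists T', [/\ F T', tiles T' (S `|` square Delta)
    & forall A, T A -> A `<=` ~` square (c1 * Delta) -> T' A].

End GoldenBee.

(* Main.v *)
Require Import Defs.
From HB Require Import structures.
From mathcomp Require Import all_boot all_order all_algebra.
From mathcomp Require Import all_classical all_reals all_analysis.
From mathcomp Require Import ring lra.
Set Implicit Arguments.
Unset Strict Implicit.
Unset Printing Implicit Defensive.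
Import Order.TTheory GRing.Theory Num.Theory.
Import numFieldNormedType.Exports.
Local Open Scope classical_set_scope.
Local Open Scope ring_scope.

(** Let tau = psi^2, so that tau^2 + tau = 1. Dissecting every bee twice replaces
    the colours of the arrows by 3 -> 3 5, 4 -> 4 6, 5 -> 3, 6 -> 4. A rectangle with
    sides 2 psi tau and 2 (1 - tau), each side carrying two arrows, can be added to
    this substitution: it splits into four small tiles around a rectangle tau^2
    times smaller, which the next double dissection turns into an exact copy of
    the first one, and the arrow rule is respected throughout. Iterating the
    substitution tiles an arbitrarily large rectangle except for a hole which
    stays inside [-1, 1]^2 while the tiles keep their size.

    The hole cannot be repaired, already for reasons of area. The rectangle has
    area 4 psi tau (1 - tau) (1 + tau)^(2 n), while a tile of size d has area
    psi tau (2 - tau) d^2. A repaired tiling keeps some far tile, so its scale is a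
    power of psi, and then 2 - tau would divide 4 (1 - tau) (1 + tau)^(2 n) in
    Z[tau]; but tau and 1 + tau = 1 / tau are units and 2 - tau has norm 5. *)

(** * The bee *)

Section Golden.
Variable R : realType.
Local Notation psi := (psi R).

(** The construction is reduced to finitely many integer computations. Dissecting twice scales
    lengths by [tau] instead of [psi]; once abscissas are divided by [psi], all vertices lie in
    Z[tau] and stay there. Every piece is then a translate of one of sixteen shapes (four kinds,
    four orientations), and what the induction needs about the children of a piece is checked on
    these. The hole is one more kind of piece, with arrows of its own: they match its neighbours
    with the small tiles that a later step places along its sides. If two pieces have
    non-overlapping rectangles, and arrows that coincide or meet at most once, then their children
    have the same property; this yields the arrow rule at every level. In the area argument the
    repaired tiling is arbitrary: its tiles may be turned by any angle, there may a priori be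
    infinitely many of them, and their boundaries overlap. Hence the need for the area of a bee in
    any position, and for open hexagons, which are disjoint and of full area. *)

Definition tau : R := psi ^+ 2.

Lemma tauE : tau = (Num.sqrt 5 - 1) / 2.
Proof.
rewrite /tau /Defs.psi sqr_sqrtr // divr_ge0 // subr_ge0 -[leLHS]sqrtr1 ler_sqrt //.
by lra.
Qed.

Lemma tau_sqr : tau ^+ 2 = 1 - tau.
Proof.
have h : (Num.sqrt 5 : R) ^+ 2 = 5 by rewrite sqr_sqrtr.
by rewrite tauE; lra.
Qed.

Lemma tau_bounds : 8 / 13 < tau < 13 / 21.
Proof.
have h : (Num.sqrt 5 : R) ^+ 2 = 5 by rewrite sqr_sqrtr.
have h0 : (0 : R) <= Num.sqrt 5 by rewrite sqrtr_ge0.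
by rewrite tauE; apply/andP; split; nra.
Qed.

Lemma psi_gt0 : 0 < psi.
Proof.
rewrite /Defs.psi sqrtr_gt0 -tauE; have /andP[h _] := tau_bounds.
by lra.
Qed.

Lemma psi_sqr : psi ^+ 2 = tau. Proof. by []. Qed.

Lemma psi_lt1 : psi < 1.
Proof. by have := psi_gt0; have := tau_bounds; have := psi_sqr; nra. Qed.

Lemma psi3 : psi ^+ 3 = psi * tau. Proof. by rewrite exprS. Qed.

Lemma psi4 : psi ^+ 4 = 1 - tau.
Proof. by rewrite -tau_sqr /tau; ring. Qed.

End Golden.

(** * Similarities in coordinates *)

Section Similarity.
Variable R : realType.
Local Notation psi := (psi R).
Local Notation tau := (tau R).

Definition sqd (p q : plane R) : R := (p.1 - q.1) ^+ 2 + (p.2 - q.2) ^+ 2.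

Lemma similarity_sqd r (f : plane R -> plane R) : similarity r f ->
  0 < r /\ forall p q, sqd (f p) (f q) = r ^+ 2 * sqd p q.
Proof.
move=> [r0 fE]; split=> // p q.
have s0 (x y : plane R) : 0 <= sqd x y by apply: addr_ge0; exact: sqr_ge0.
rewrite -(sqr_sqrtr (s0 (f p) _)) -[Num.sqrt _]/(dist2 _ _) fE exprMn.
by rewrite -[dist2 _ _]/(Num.sqrt (sqd _ _)) sqr_sqrtr.
Qed.

Lemma sqd_similarity r (f : plane R -> plane R) : 0 < r ->
  (forall p q, sqd (f p) (f q) = r ^+ 2 * sqd p q) -> similarity r f.
Proof.
move=> r0 fE; split=> // p q.
by rewrite /dist2 -/(sqd _ _) fE sqrtrM ?sqr_ge0// sqrtr_sqr gtr0_norm.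
Qed.

(** The images of the unit points, seen from the image of the origin, have length [r] and are
    orthogonal by polarisation; [e], their determinant over [r ^+ 2], is the sign of the
    orientation. Any other image point is recovered from its squared distances to these three. *)
Lemma similarity_affine r (f : plane R -> plane R) : similarity r f ->
  exists a b e p q, [/\ e ^+ 2 = 1, a ^+ 2 + b ^+ 2 = r ^+ 2 &
    forall x y, f (x, y) = (p + a * x - e * b * y, q + b * x + e * a * y)].
Proof.
move=> /similarity_sqd[r0 fE].
have r2 : r ^+ 2 != 0 by rewrite expf_eq0 /= gt_eqF.
have [ [q1 q2] fO] : exists o, f (0, 0) = o by eexists.
have [ [a1 a2] fA] : exists o, f (1, 0) = o by eexists.
have [ [b1 b2] fB] : exists o, f (0, 1) = o by eexists.
have AO := fE (1, 0) (0, 0); have BO := fE (0, 1) (0, 0); have AB := fE (1, 0) (0, 1).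
rewrite /sqd fA fO /= in AO; rewrite /sqd fB fO /= in BO; rewrite /sqd fA fB /= in AB.
have [a aE] : exists a, a1 = q1 + a by exists (a1 - q1); rewrite subrKC.
have [b bE] : exists b, a2 = q2 + b by exists (a2 - q2); rewrite subrKC.
have [c cE] : exists c, b1 = q1 + c by exists (b1 - q1); rewrite subrKC.
have [d dE] : exists d, b2 = q2 + d by exists (b2 - q2); rewrite subrKC.
subst a1 a2 b1 b2.
have ab : a ^+ 2 + b ^+ 2 = r ^+ 2 by lra.
have cd : c ^+ 2 + d ^+ 2 = r ^+ 2 by lra.
have acbd : a * c + b * d = 0 by lra.
pose e := (a * d - b * c) / r ^+ 2.
have er : e * r ^+ 2 = a * d - b * c by rewrite divfK.
move: e er => e er.
have cE : c = - (e * b).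
  apply: (mulIf r2); rewrite mulNr mulrAC er -ab.
  by rewrite -[RHS]addr0 -(mulr0 a) -acbd; ring.
have dE : d = e * a.
  apply: (mulIf r2); rewrite mulrAC er -ab.
  by rewrite -[RHS]addr0 -(mulr0 b) -acbd; ring.
have e2 : e ^+ 2 = 1 by apply: (mulIf r2); rewrite mul1r -[in RHS]cd cE dE -ab; ring.
exists a, b, e, q1, q2; split=> // x y.
have ZO := fE (x, y) (0, 0); have ZA := fE (x, y) (1, 0); have ZB := fE (x, y) (0, 1).
rewrite /sqd fO /= in ZO; rewrite /sqd fA /= in ZA; rewrite /sqd fB /= in ZB.
case: (f (x, y)) ZO ZA ZB => [w1 w2] /=.
have [z1 z1E] : exists a, w1 = q1 + a by exists (w1 - q1); rewrite subrKC.
have [z2 z2E] : exists a, w2 = q2 + a by exists (w2 - q2); rewrite subrKC.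
subst w1 w2 => ZO ZA ZB.
have zA : a * z1 + b * z2 = r ^+ 2 * x by lra.
have zB : c * z1 + d * z2 = r ^+ 2 * y by lra.
have [] : z1 = a * x - e * b * y /\ z2 = b * x + e * a * y; last first.
  by move=> -> ->; congr (_, _); ring.
split; apply: (mulfI r2).
  rewrite [RHS](_ : _ = a * (r ^+ 2 * x) - e * b * (r ^+ 2 * y)); last by ring.
  rewrite -zA -zB cE dE -ab.
  rewrite [RHS](_ : _ = a ^+ 2 * z1 + e ^+ 2 * b ^+ 2 * z1 + a * b * z2 * (1 - e ^+ 2)); last by ring.
  by rewrite e2; ring.
rewrite [RHS](_ : _ = b * (r ^+ 2 * x) + e * a * (r ^+ 2 * y)); last by ring.
rewrite -zA -zB cE dE -ab.
rewrite [RHS](_ : _ = b ^+ 2 * z2 + e ^+ 2 * a ^+ 2 * z2 + a * b * z1 * (1 - e ^+ 2)); last by ring.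
by rewrite e2; ring.
Qed.

End Similarity.

(** * A bee determines its similarity *)

Section Bee.
Variable R : realType.
Local Notation psi := (psi R).
Local Notation tau := (tau R).
Local Notation bee := (@bee R).

Lemma beeP (p : plane R) : bee p <->
  (0 <= p.1 <= psi /\ 0 <= p.2 <= tau) \/ (0 <= p.1 <= psi * tau /\ 0 <= p.2 <= 1).
Proof.
rewrite /bee /= !in_itv /= psi3.
by split => -[[? ?]|[? ?]]; [left|right|left|right].
Qed.

(** Within one arm the squared diameter is below [1 + tau]. Across the arms the coordinates differ
    by at most [psi] and 1, and equality in both singles out the two corners. *)
Lemma bee_diam (x y : plane R) : bee x -> bee y ->
  sqd x y <= 1 + tau /\
  (1 + tau <= sqd x y -> x = (0, 1) /\ y = (psi, 0) \/ x = (psi, 0) /\ y = (0, 1)).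
Proof.
have := @psi_gt0 R; have := @psi_sqr R; have := @tau_bounds R; have := @tau_sqr R.
set t := tau; set s := psi => tt /andP[t1 t2] ss s0.
have sq (a b : R) : - b <= a -> a <= b -> a ^+ 2 <= b ^+ 2 by move=> *; nra.
have main (u v : plane R) : 0 <= u.1 <= s /\ 0 <= u.2 <= t ->
    0 <= v.1 <= s * t /\ 0 <= v.2 <= 1 ->
    sqd u v <= 1 + t /\ (1 + t <= sqd u v -> u = (s, 0) /\ v = (0, 1)).
  case: u v => [u1 u2] [v1 v2] /= [/andP[? ?] /andP[? ?]] [/andP[? ?] /andP[? ?]].
  have st : s * t <= s by nra.
  have h1 : (u1 - v1) ^+ 2 <= t by rewrite -ss sq//; lra.
  have h2 : (u2 - v2) ^+ 2 <= 1 by rewrite -(expr1n _ 2) sq//; lra.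
  rewrite /sqd /=; split; first lra.
  move=> h.
  have e1 : (u1 - v1) ^+ 2 = s ^+ 2 by lra.
  have e2 : (u2 - v2) ^+ 2 = 1 by lra.
  have f1 : (u1 - v1 - s) * (u1 - v1 + s) = 0 by rewrite -subr_sqr e1 subrr.
  have f2 : (u2 - v2 - 1) * (u2 - v2 + 1) = 0 by rewrite -subr_sqr e2; ring.
  have st' : s * t < s by nra.
  have {f1}f1 : u1 - v1 = s.
    by move/eqP: f1; rewrite mulf_eq0 => /orP[]/eqP ?; lra.
  have {f2}f2 : v2 - u2 = 1.
    by move/eqP: f2; rewrite mulf_eq0 => /orP[]/eqP ?; lra.
  by split; congr (_, _); lra.
have sqdC (u v : plane R) : sqd u v = sqd v u by rewrite /sqd; ring.
move=> /beeP; rewrite -/s -/t => bx /beeP; rewrite -/s -/t => by_.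
case: bx by_ => [xA|xB] [yA|yB].
- case: x y xA yA => [u1 u2] [v1 v2] /= [/andP[? ?] /andP[? ?]] [/andP[? ?] /andP[? ?]].
  have h1 : (u1 - v1) ^+ 2 <= t by rewrite -ss sq//; lra.
  have h2 : (u2 - v2) ^+ 2 <= t ^+ 2 by rewrite sq//; lra.
  by rewrite /sqd /=; split=> [|h]; [lra|exfalso; lra].
- by have [? h] := main _ _ xA yB; split=> // /h; right.
- rewrite sqdC; have [? h] := main _ _ yA xB; split=> // /h [? ?]; left; split=> //.
- case: x y xB yB => [u1 u2] [v1 v2] /= [/andP[? ?] /andP[? ?]] [/andP[? ?] /andP[? ?]].
  have h1 : (u1 - v1) ^+ 2 <= (s * t) ^+ 2 by rewrite sq//; lra.
  have h2 : (u2 - v2) ^+ 2 <= 1 by rewrite -(expr1n _ 2) sq//; lra.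
  have h3 : (s * t) ^+ 2 < t by rewrite exprMn ss; nra.
  by rewrite /sqd /=; split=> [|h]; [lra|exfalso; lra].
Qed.

Lemma bee_P : bee ((0, 1) : plane R).
Proof.
by apply/beeP; right => /=; have := @psi_gt0 R; have /andP[? ?] := @tau_bounds R; nra.
Qed.

Lemma bee_Q : bee ((psi, 0) : plane R).
Proof.
by apply/beeP; left => /=; have := @psi_gt0 R; have /andP[? ?] := @tau_bounds R; nra.
Qed.

Lemma bee_O : bee ((0, 0) : plane R).
Proof.
by apply/beeP; left => /=; have := @psi_gt0 R; have /andP[? ?] := @tau_bounds R; nra.
Qed.

Lemma sqd_PQ : sqd (0, 1) (psi, 0) = 1 + tau :> R.
Proof. by rewrite /sqd /= -psi_sqr; ring. Qed.

Lemma image_bee_ratio_le r s (f g : plane R -> plane R) :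
  similarity r f -> similarity s g -> f @` bee `<=` g @` bee -> r <= s.
Proof.
move=> /similarity_sqd[r0 fE] /similarity_sqd[s0 gE] fg.
have [x bx xE] := fg _ (imageP f bee_P); have [y by_ yE] := fg _ (imageP f bee_Q).
have := fE (0, 1) (psi, 0); rewrite -xE -yE gE sqd_PQ => h.
have [d _] := bee_diam bx by_.
rewrite -(@ler_pXn2r _ 2%N) ?nnegrE ?(ltW r0) ?(ltW s0)// -(@ler_pM2r R (1 + tau)).
  by rewrite -h ler_pM2l ?exprn_gt0.
by have /andP[? ?] := @tau_bounds R; lra.
Qed.

Lemma image_bee_ratio r s (f g : plane R -> plane R) :
  similarity r f -> similarity s g -> f @` bee = g @` bee -> r = s.
Proof.
move=> fs gs fg; apply/eqP; rewrite eq_le.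
by rewrite (image_bee_ratio_le fs gs) ?(image_bee_ratio_le gs fs) ?fg.
Qed.

(* The far corners (0, 1) and (psi, 0) realise the diameter and nothing else
   does; the right-angled corner is then the only point of the bee at distances
   1 and psi from them, in that order or swapped. *)
Lemma image_bee_inj r (f g : plane R -> plane R) :
  similarity r f -> similarity r g -> f @` bee = g @` bee -> f = g.
Proof.
move=> fs gs fg.
have /similarity_sqd[r0 fE] := fs; have /similarity_sqd[_ gE] := gs.
have r2 : r ^+ 2 != 0 by rewrite expf_eq0 /= gt_eqF.
have sub z : bee z -> exists2 x, bee x & g x = f z.
  by move=> bz; have := imageP f bz; rewrite fg.
clear fg.
have [x bx xE] := sub _ bee_P; have [y by_ yE] := sub _ bee_Q.
have [z bz zE] := sub _ bee_O.
have dE u v u' v' : g u' = f u -> g v' = f v -> sqd u' v' = sqd u v.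
  by move=> e1 e2; apply: (mulfI r2); rewrite -(fE u v) -(gE u' v') e1 e2.
have [_] := bee_diam bx by_; rewrite (dE _ _ _ _ xE yE) sqd_PQ lexx => /(_ isT) xy.
have zx := dE _ _ _ _ zE xE; have zy := dE _ _ _ _ zE yE.
have := @psi_gt0 R; have := @psi_sqr R; have := @tau_bounds R; have := @tau_sqr R.
rewrite /sqd in zx zy; move: xy zx zy.
set t := tau; set s := psi => xy zx zy tt /andP[t1 t2] ss s0.
have [x0 y0 z0] : [/\ x = (0, 1), y = (s, 0) & z = (0, 0)].
  case: xy => -[xe ye]; rewrite xe ye /= in zx zy.
    split=> //; case: z {zE} bz zx zy => z1 z2 /=.
    rewrite !sub0r !sqrrN !(expr1n, expr0n, subr0, addr0, add0r) /= => bz zx zy.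
    have e : s * z1 = z2 by lra.
    (* The circles around the far corners meet at the origin and at its mirror image in the line
       joining them. The latter has ordinate [2 * t / (1 + t)], above [t], whereas [z1 <= s] keeps
       [z2] at most [t]. *)
    have e2 : z2 * (z2 * (1 + t) - 2 * t) = 0.
      have : t * z1 ^+ 2 = z2 ^+ 2 by rewrite -e exprMn ss.
      by nra.
    have bb : z1 <= s.
      by move/beeP: bz => /=; rewrite -/s -/t => -[] [/andP[? ?] _] //; nra.
    have z2b : z2 <= t by rewrite -e -ss expr2 ler_pM2l.
    have z20 : z2 = 0.
      move/eqP: e2; rewrite mulf_eq0 => /orP[/eqP //|/eqP ?]; nra.
    have /eqP : s * z1 = 0 by rewrite e.
    by rewrite mulf_eq0 (gt_eqF s0) /= => /eqP ->; rewrite z20.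
  (* With the far corners swapped, the circles meet at [(psi, 1)] and at a point of negative
     abscissa, both outside the bee. *)
  case: z {zE} bz zx zy => z1 z2 /beeP /=; rewrite -/s -/t => bz.
  rewrite !sub0r !sqrrN !(expr1n, expr0n, subr0, addr0, add0r) /= => zx zy.
  exfalso.
  have z2E : z2 = s * z1 + 1 - t by lra.
  have : (z1 - s) * ((1 + t) * z1 + s * (1 - t)) = 0.
    have e : s ^+ 2 * z1 ^+ 2 = t * z1 ^+ 2 by rewrite ss.
    have e' : z1 ^+ 2 + (s * z1 - t) ^+ 2 = t by rewrite -[in RHS]ss -zy z2E; ring.
    have -> : (z1 - s) * ((1 + t) * z1 + s * (1 - t)) =
      z1 ^+ 2 + t * z1 ^+ 2 - 2 * (s * t * z1) - s ^+ 2 * (1 - t) by ring.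
    by rewrite ss -e; lra.
  have z10 : 0 <= z1 by case: bz => -[/andP[]].
  move/eqP; rewrite mulf_eq0 => /orP[/eqP z1s|/eqP]; last by nra.
  have {}z1s : z1 = s by lra.
  have {}z2E : z2 = 1 by rewrite z2E z1s -expr2 ss; ring.
  by case: bz; rewrite z1s z2E => -[/andP[? ?] /andP[? ?]]; nra.
(* [f] and [g] agree at three non-collinear points, and the distances from [f p] to these determine
   it. *)
apply/funext => p.
have [a [b [e [p1 [p2 [e2 ab gA]]]]]] := similarity_affine gs.
have hx := fE p (0, 1); have hy := fE p (s, 0); have hz := fE p (0, 0).
rewrite -xE -yE -zE x0 y0 z0 in hx hy hz.
have hx' := gE p (0, 1); have hy' := gE p (s, 0); have hz' := gE p (0, 0).
rewrite -hx in hx'; rewrite -hy in hy'; rewrite -hz in hz'.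
move: hx' hy' hz'; case: (f p) => u1 u2; case: (g p) => v1 v2.
rewrite !gA /sqd /= !(mulr0, mulr1, addr0, subr0) => hx' hy' hz'.
pose w1 := u1 - v1; pose w2 := u2 - v2.
have h1 : s * (a * w1 + b * w2) = 0 by rewrite /w1 /w2; lra.
have h2 : e * (a * w2 - b * w1) = 0 by rewrite /w1 /w2; lra.
have {}h1 : a * w1 + b * w2 = 0.
  by move/eqP: h1; rewrite mulf_eq0 (gt_eqF s0) => /eqP.
have {}h2 : a * w2 - b * w1 = 0.
  have e0 : e != 0 by apply: contra_eq_neq e2 => ->; rewrite expr0n /= eq_sym oner_eq0.
  by move/eqP: h2; rewrite mulf_eq0 (negbTE e0) => /eqP.
have w10 : w1 = 0.
  apply: (mulfI r2); rewrite -ab.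
  rewrite [LHS](_ : _ = a * (a * w1 + b * w2) - b * (a * w2 - b * w1)); last by ring.
  by rewrite h1 h2; ring.
have w20 : w2 = 0.
  apply: (mulfI r2); rewrite -ab.
  rewrite [LHS](_ : _ = b * (a * w1 + b * w2) + a * (a * w2 - b * w1)); last by ring.
  by rewrite h1 h2; ring.
by congr (_, _); apply/eqP; rewrite -subr_eq0 -/w1 -/w2 ?w10 ?w20.
Qed.

End Bee.

(** * Area *)

Section Area.
Variable R : realType.
Local Notation la := (@lebesgue_measure R).

Definition translation (a : R) (x : measurableTypeR R) : measurableTypeR R := x + a.

Lemma measurable_translation a : measurable_fun setT (translation a).
Proof. exact: measurable_realfun.measurable_funD. Qed.

HB.instance Definition _ a := isMeasurableFun.Build _ _ _ _ (translation a)
  (measurable_translation a).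

Lemma lebesgue_measure_translate (a : R) (A : set (measurableTypeR R)) :
  measurable A -> la ((fun x => x + a) @^-1` A) = la A.
Proof.
move=> mA.
apply: esym; apply: (@lebesgue_measure_unique R (pushforward la (translation a))) => //.
move=> X [[x y]] /= _ <-; rewrite /pushforward /=.
rewrite (_ : _ @^-1` _ = `]x - a, y - a]%classic); last first.
  by apply/seteqP; split => z /=; rewrite !in_itv /= ltrBlDr lerBrDr.
rewrite !lebesgue_measure_itv /= !lte_fin ltrD2r; case: ifP => // _.
by rewrite -!EFinB; congr (_%:E); ring.
Qed.

Definition plane_area : set (measurableTypeR R * measurableTypeR R) -> \bar R := (la \x la)%E.
HB.instance Definition _ := Measure.on plane_area.

(** [plane_area] integrates vertical sections; horizontal shears call for the other order of
    integration. *)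
Lemma areaE2 (A : set (measurableTypeR R * measurableTypeR R)) : measurable A ->
  plane_area A = (\int[la]_y la (ysection A y))%E.
Proof.
move=> mA.
rewrite /plane_area (@product_measure_unique _ _ _ _ _ la la (la \x^ la)%E) //.
by move=> A1 A2 mA1 mA2; exact: (product_measure2E la la mA1 mA2).
Qed.

(** Each vertical section is merely translated, by an amount depending on its abscissa. *)
Lemma area_shear1 (k a : R) (A : set (measurableTypeR R * measurableTypeR R)) : measurable A ->
  plane_area ((fun p => (p.1, p.2 + (k * p.1 + a))) @^-1` A) = plane_area A.
Proof.
move=> mA; rewrite /plane_area /product_measure1; apply: eq_integral => x _ /=.
rewrite -[RHS](lebesgue_measure_translate (k * x + a)); last exact: measurable_xsection.
by congr (la _); apply/seteqP; split => y /=; rewrite /xsection /= ?inE.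
Qed.

Lemma area_shear2 (k a : R) (A : set (measurableTypeR R * measurableTypeR R)) : measurable A ->
  plane_area ((fun p => (p.1 + (k * p.2 + a), p.2)) @^-1` A) = plane_area A.
Proof.
move=> mA; rewrite !areaE2//; last first.
  rewrite -[X in measurable X]setTI.
  have : measurable_fun setT (fun p : measurableTypeR R * measurableTypeR R =>
      (p.1 + (k * p.2 + a), p.2) : measurableTypeR R * measurableTypeR R).
    apply/measurable_fun_pair => //.
    apply: measurable_realfun.measurable_funD => //; apply: measurable_realfun.measurable_funD => //.
    exact: measurable_realfun.measurable_funM.
  exact.
apply: eq_integral => x _ /=.
rewrite -[RHS](lebesgue_measure_translate (k * x + a)); last exact: measurable_ysection.
by congr (la _); apply/seteqP; split => y /=; rewrite /ysection /= ?inE.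
Qed.
End Area.

(** * Area of a similar copy of the bee *)

Section TileArea.
Variable R : realType.
Local Notation psi := (psi R).
Local Notation tau := (tau R).
Local Notation la := (@lebesgue_measure R).
Local Notation mR := (measurableTypeR R).
Local Notation mplane := (measurableTypeR R * measurableTypeR R)%type.
Local Notation area := (@plane_area R).

Lemma measurable_shear1 (k a : R) :
  measurable_fun setT (fun p : mplane => (p.1, p.2 + (k * p.1 + a)) : mplane).
Proof.
apply/measurable_fun_pair => //.
apply: measurable_realfun.measurable_funD => //; apply: measurable_realfun.measurable_funD => //.
exact: measurable_realfun.measurable_funM.
Qed.

Lemma measurable_shear2 (k a : R) :
  measurable_fun setT (fun p : mplane => (p.1 + (k * p.2 + a), p.2) : mplane).
Proof.
apply/measurable_fun_pair => //.
apply: measurable_realfun.measurable_funD => //; apply: measurable_realfun.measurable_funD => //.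
exact: measurable_realfun.measurable_funM.
Qed.

(* A rotation of angle different from pi is a product of three shears. *)
Lemma area_rotation (c s v1 v2 : R) (A : set mplane) :
  c ^+ 2 + s ^+ 2 = 1 -> c != -1 -> measurable A ->
  let B := (fun p => (c * p.1 - s * p.2 + v1, s * p.1 + c * p.2 + v2)) @^-1` A in
  measurable B /\ area B = area A.
Proof.
(* [k] is minus the tangent of half the angle: shears by [k], [s], [k] compose to the rotation, and
   two more with coefficient 0 give the translation. *)
move=> cs c1 mA B; have [k kE] : exists k, k = - (s / (1 + c)) by eexists.
have c10 : 1 + c != 0 by rewrite addrC -[1]opprK subr_eq0.
have kc : k * (1 + c) = - s by rewrite kE mulNr divfK.
have ks : k * s = c - 1.
  apply: (mulIf c10); rewrite mulrAC kc; move: cs => /eqP; rewrite -subr_eq0 => /eqP cs.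
  by rewrite -[LHS]addr0 -cs; ring.
have shears x y : (x + (k * y + 0) + (k * (y + (s * (x + (k * y + 0)) + 0)) + 0) +
      (0 * (y + (s * (x + (k * y + 0)) + 0)) + v1),
    y + (s * (x + (k * y + 0)) + 0) +
      (0 * (x + (k * y + 0) + (k * (y + (s * (x + (k * y + 0)) + 0)) + 0) +
      (0 * (y + (s * (x + (k * y + 0)) + 0)) + v1)) + v2)) =
    (c * x - s * y + v1, s * x + c * y + v2).
  clear B mA A; congr (_, _).
    transitivity ((1 + k * s) * x + (k * (1 + c) + k * (k * s - (c - 1))) * y + v1); first by ring.
    by rewrite kc ks; ring.
  transitivity (s * x + (1 + k * s) * y + v2); first by ring.
  by rewrite ks; ring.
pose E1 := (fun p => (p.1, p.2 + (0 * p.1 + v2))) @^-1` A.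
have mE1 : measurable E1 by rewrite -[E1]setTI; exact: measurable_shear1.
pose E2 := (fun p => (p.1 + (0 * p.2 + v1), p.2)) @^-1` E1.
have mE2 : measurable E2 by rewrite -[E2]setTI; exact: measurable_shear2.
pose E3 := (fun p => (p.1 + (k * p.2 + 0), p.2)) @^-1` E2.
have mE3 : measurable E3 by rewrite -[E3]setTI; exact: measurable_shear2.
pose E4 := (fun p => (p.1, p.2 + (s * p.1 + 0))) @^-1` E3.
have mE4 : measurable E4 by rewrite -[E4]setTI; exact: measurable_shear1.
pose E5 := (fun p => (p.1 + (k * p.2 + 0), p.2)) @^-1` E4.
have mE5 : measurable E5 by rewrite -[E5]setTI; exact: measurable_shear2.
have -> : B = E5.
  by rewrite predeqE => -[x y]; rewrite /B /E5 /E4 /E3 /E2 /E1 /preimage /mkset /= shears.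
split=> //; transitivity (area E4); first exact: (area_shear2 k 0 mE4).
transitivity (area E3); first exact: (area_shear1 s 0 mE3).
transitivity (area E2); first exact: (area_shear2 k 0 mE2).
transitivity (area E1); first exact: (area_shear2 0 v1 mE1).
exact: (area_shear1 0 v2 mA).
Qed.

(* [true] gives the closed half-line at its left end and the open one at its
   right end. *)
Definition itvB (b1 : bool) (x : R) (b2 : bool) (y : R) : interval R :=
  Interval (BSide b1 x) (BSide b2 y).

(** For negative [k] the endpoints swap and a closed left end becomes a closed right end, hence the
    negated flags in exchanged order. *)
Lemma lebesgue_measure_scaled_itv (k x y : R) (b1 b2 : bool) : k != 0 -> x < y ->
  measurable ([set z | k * z \in itvB b1 x b2 y] : set mR) /\
  la [set z | k * z \in itvB b1 x b2 y] = ((y - x) / `|k|)%:E.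
Proof.
move=> k0 xy; case: (ltrgt0P k) k0 => // kp _.
  have -> : [set z | k * z \in itvB b1 x b2 y] = [set` itvB b1 (x / k) b2 (y / k)].
    apply/seteqP; split => z /=; rewrite !in_itv /=;
    by case: b1 b2 => -[]; rewrite /= !(ler_pdivrMr, ltr_pdivrMr, ler_pdivlMr, ltr_pdivlMr) // mulrC.
  split; first exact: measurable_itv.
  rewrite lebesgue_measure_itv /= lte_fin ltr_pM2r ?invr_gt0// xy.
  by rewrite -EFinB -mulrBl.
have -> : [set z | k * z \in itvB b1 x b2 y] = [set` itvB (~~ b2) (y / k) (~~ b1) (x / k)].
  apply/seteqP; split => z /=; rewrite !in_itv /= andbC;
  by case: b1 b2 => -[]; rewrite /= !(ler_ndivrMr, ltr_ndivrMr, ler_ndivlMr, ltr_ndivlMr) // mulrC.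
split; first exact: measurable_itv.
rewrite lebesgue_measure_itv /= lte_fin ltr_nM2r ?invr_lt0// xy.
by rewrite -EFinB invrN mulrN -mulNr opprB mulrBl.
Qed.

Lemma area_scaled_rect (k1 k2 x1 y1 x2 y2 : R) (b1 b2 b3 b4 : bool) :
  k1 != 0 -> k2 != 0 -> x1 < y1 -> x2 < y2 ->
  let A := [set z : mplane | k1 * z.1 \in itvB b1 x1 b2 y1 /\ k2 * z.2 \in itvB b3 x2 b4 y2] in
  measurable A /\ area A = ((y1 - x1) * (y2 - x2) / (`|k1| * `|k2|))%:E.
Proof.
move=> k10 k20 xy1 xy2 A.
have [m1 e1] := lebesgue_measure_scaled_itv b1 b2 k10 xy1.
have [m2 e2] := lebesgue_measure_scaled_itv b3 b4 k20 xy2.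
have -> : A = [set z | k1 * z \in itvB b1 x1 b2 y1] `*` [set z | k2 * z \in itvB b3 x2 b4 y2] by [].
split; first exact: measurableX.
rewrite /plane_area product_measure1E//= e1 e2 -EFinM; congr (_%:E).
by rewrite invfM; ring.
Qed.

(** The closed bee for [true], its interior for [false]. The cut at height [tau] makes the two
    rectangles disjoint, so that their areas add; the cutting segment belongs to the lower rectangle
    in the closed case and to the upper one in the open case. *)
Definition hexagon (b : bool) : set (plane R) :=
  ([set` itvB b 0 (~~ b) psi] `*` [set` itvB b 0 (~~ b) tau]) `|`
  ([set` itvB b 0 (~~ b) (psi * tau)] `*` [set` itvB (~~ b) tau (~~ b) 1]).

Lemma hexagon_bee : hexagon true = @bee R.
Proof.
have := @psi_gt0 R; have /andP[t1 t2] := @tau_bounds R => s0.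
apply/seteqP; split => -[x y]; rewrite beeP /hexagon /= !in_itv /=.
  move=> [[/andP[? ?] /andP[? ?]]|[/andP[? ?] /andP[? ?]]]; [left|right]; split; apply/andP; split; lra.
move=> [[/andP[? ?] /andP[? ?]]|[/andP[? ?] /andP[? ?]]].
  by left; split; apply/andP.
have [yt|yt] := leP y tau; [left|right]; split; apply/andP; split => //; nra.
Qed.

Definition bee_area : R := psi * tau * (2 - tau).

Lemma area_scaled_hexagon (k1 k2 : R) (b : bool) : k1 != 0 -> k2 != 0 ->
  let A := [set z : mplane | hexagon b (k1 * z.1, k2 * z.2)] in
  measurable A /\ area A = (bee_area / (`|k1| * `|k2|))%:E.
Proof.
move=> k10 k20 A.
have s0 := @psi_gt0 R; have /andP[t1 t2] := @tau_bounds R.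
have t0 : 0 < tau by lra.
have t1' : tau < 1 by lra.
have [mB aB] := area_scaled_rect b (~~ b) b (~~ b) k10 k20 s0 t0.
have [mC aC] := area_scaled_rect b (~~ b) (~~ b) (~~ b) k10 k20 (mulr_gt0 s0 t0) t1'.
have -> : A = [set z : mplane | k1 * z.1 \in itvB b 0 (~~ b) psi /\ k2 * z.2 \in itvB b 0 (~~ b) tau] `|`
  [set z : mplane | k1 * z.1 \in itvB b 0 (~~ b) (psi * tau) /\ k2 * z.2 \in itvB (~~ b) tau (~~ b) 1].
  by [].
split; first exact: measurableU.
rewrite measureU//=.
  rewrite aB aC -EFinD; congr (_%:E).
  by rewrite -mulrDl /bee_area; congr (_ / _); ring.
apply/seteqP; split => // -[x y] /= [] [_ +] [_].
rewrite !in_itv /=; case: b {A mB aB mC aC} => /= /andP[? ?] /andP[? ?]; lra.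
Qed.

(** [f] is undone by a rigid motion followed by a scaling of each axis, with the orientation [e]
    absorbed by the second scaling factor. *)
Lemma similarity_image_area r (f : plane R -> plane R) (b : bool) : similarity r f ->
  measurable (f @` hexagon b : set mplane) /\ area (f @` hexagon b) = (r ^+ 2 * bee_area)%:E.
Proof.
move=> fs; have [r0 _] := fs; have [a [c [e [p [q [e2 ac fE]]]]]] := similarity_affine fs.
have r0' : r != 0 by rewrite gt_eqF.
have ab : (a / r) ^+ 2 + (- c / r) ^+ 2 = 1.
  by rewrite !exprMn sqrrN -mulrDl ac -exprMn divff// expr1n.
(* The half turn is the one rotation that the shears miss; there the rotation becomes the identity
   and both scaling factors change sign. *)
pose h : R := if a / r == -1 then -1 else 1.
have h2 : h ^+ 2 = 1 by rewrite /h; case: ifP => _; rewrite ?sqrrN expr1n.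
have nh : `|h| = 1 by rewrite /h; case: ifP => _; rewrite ?normrN normr1.
have ne : `|e| = 1 by apply/eqP; rewrite -sqrp_eq1 // -normrX e2 normr1.
have k1 : h / r != 0 by rewrite -normr_gt0 normrM nh mul1r normr_gt0 invr_eq0.
have k2 : h * e / r != 0 by rewrite -normr_gt0 !normrM nh ne !mul1r normr_gt0 invr_eq0.
have h1 : h * (a / r) != -1.
  rewrite /h; case: (eqVneq (a / r) (-1)) => [->|?]; last by rewrite mul1r.
  by rewrite mulN1r opprK -subr_eq0 opprK -[1 + 1]/(2%:R) pnatr_eq0.
have cs : (h * (a / r)) ^+ 2 + (h * (- c / r)) ^+ 2 = 1 by rewrite exprMn [X in _ + X]exprMn -mulrDr ab h2 mulr1.
have [mA aA] := area_scaled_hexagon b k1 k2.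
pose v1 := - (h * (a * p + c * q) / r); pose v2 := - (h * (a * q - c * p) / r).
have [mB aB] := area_rotation v1 v2 cs h1 mA.
suff -> : f @` hexagon b = (fun z => (h * (a / r) * z.1 - h * (- c / r) * z.2 + v1,
    h * (- c / r) * z.1 + h * (a / r) * z.2 + v2)) @^-1` [set z | hexagon b (h / r * z.1, h * e / r * z.2)].
  split; first exact: mB.
  rewrite aB aA !normrM nh ne !mul1r normfV (gtr0_norm r0) -invfM invrK.
  by rewrite [_ * (r * r)]mulrC.
have r2 : r ^+ 2 != 0 by rewrite expf_eq0.
have rr : r ^+ 2 / r ^+ 2 = 1 by rewrite divff.
apply/seteqP; split => -[x y] /=.
  move=> [[u w]] huw; rewrite fE => -[<- <-].
  set g1 := h / r * _; set g2 := h * e / r * _.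
  have -> : g1 = u.
    rewrite -[RHS]mul1r -rr -{1}ac.
    transitivity (h ^+ 2 * ((a ^+ 2 + c ^+ 2) / r ^+ 2 * u)); last by rewrite h2 mul1r.
    by rewrite /g1 /v1 -exprVn; field.
  have -> // : g2 = w.
  transitivity (h ^+ 2 * (e ^+ 2 * ((a ^+ 2 + c ^+ 2) / r ^+ 2 * w))).
    by rewrite /g2 /v2; field.
  by rewrite h2 e2 ac rr !mul1r.
set g1 := h / r * _; set g2 := h * e / r * _.
move=> hg; exists (g1, g2) => //; rewrite fE; congr (_, _).
  rewrite /g1 /g2 /v1 /v2.
  transitivity (p + h ^+ 2 * ((a ^+ 2 + e ^+ 2 * c ^+ 2) / r ^+ 2 * (x - p)) +
    h ^+ 2 * (a * c * (1 - e ^+ 2) / r ^+ 2 * (y - q))); first by field.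
  by rewrite h2 e2 !mul1r ac rr; ring.
rewrite /g1 /g2 /v1 /v2.
transitivity (q + h ^+ 2 * ((c ^+ 2 + e ^+ 2 * a ^+ 2) / r ^+ 2 * (y - q)) +
    h ^+ 2 * (a * c * (1 - e ^+ 2) / r ^+ 2 * (x - p))); first by field.
by rewrite h2 e2 !mul1r [c ^+ 2 + _]addrC ac rr; ring.
Qed.

End TileArea.

(** * Area of a tiled set *)

Section TilingArea.
Variable R : realType.
Local Notation psi := (psi R).
Local Notation tau := (tau R).
Local Notation mplane := (measurableTypeR R * measurableTypeR R)%type.
Local Notation area := (@plane_area R).
Local Notation alpha := (bee_area R).

Lemma continuous_affine (k1 k2 k0 : R) :
  continuous (fun z : plane R => k1 * z.1 + k2 * z.2 + k0).
Proof.
move=> z; apply: cvgD; last exact: cvg_cst.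
apply: cvgD; apply: cvgM; try exact: cvg_cst; [exact: cvg_fst|exact: cvg_snd].
Qed.

Lemma hexagon_sub (b : bool) : hexagon (R := R) false `<=` hexagon b.
Proof.
case: b => // -[x y]; rewrite /hexagon /= !in_itv /=.
move=> [[/andP[? ?] /andP[? ?]]|[/andP[? ?] /andP[? ?]]].
  by left; split; apply/andP; split; exact: ltW.
have [->|yt] := eqVneq y tau; last first.
  by right; split; apply/andP; split; rewrite ?ltW// lt_neqAle eq_sym yt.
left; have := @psi_gt0 R; have /andP[? ?] := @tau_bounds R => ?.
by split; apply/andP; split; nra.
Qed.

Lemma open_image_hexagon r (f : plane R -> plane R) : similarity r f ->
  open (f @` hexagon false).
Proof.
move=> fs; have [r0 _] := fs; have [a [c [e [p [q [e2 ac fE]]]]]] := similarity_affine fs.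
have r2 : r ^+ 2 != 0 by rewrite expf_eq0 /= gt_eqF.
have r0' : r != 0 by rewrite gt_eqF.
pose u (z : plane R) := a / r ^+ 2 * z.1 + c / r ^+ 2 * z.2 + - ((a * p + c * q) / r ^+ 2).
pose w (z : plane R) := - (e * c) / r ^+ 2 * z.1 + e * a / r ^+ 2 * z.2 + e * (c * p - a * q) / r ^+ 2.
have uf x y : u (f (x, y)) = x.
  rewrite fE /u /=; transitivity ((a ^+ 2 + c ^+ 2) / r ^+ 2 * x); first by field.
  by rewrite ac divff// mul1r.
have wf x y : w (f (x, y)) = y.
  rewrite fE /w /=; transitivity (e ^+ 2 * ((a ^+ 2 + c ^+ 2) / r ^+ 2 * y)); first by field.
  by rewrite ac divff// e2 !mul1r.
have fuw z : f (u z, w z) = z.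
  case: z => x y; rewrite fE /u /w /=; congr (_, _).
    transitivity (p + (a ^+ 2 + e ^+ 2 * c ^+ 2) / r ^+ 2 * (x - p) +
      a * c * (1 - e ^+ 2) / r ^+ 2 * (y - q)); first by field.
    by rewrite e2 !mul1r ac divff//; ring.
  transitivity (q + (c ^+ 2 + e ^+ 2 * a ^+ 2) / r ^+ 2 * (y - q) +
      a * c * (1 - e ^+ 2) / r ^+ 2 * (x - p)); first by field.
  by rewrite e2 !mul1r [c ^+ 2 + _]addrC ac divff//; ring.
have cu : continuous u by exact: continuous_affine.
have cw : continuous w by exact: continuous_affine.
have ou x y (g : plane R -> R) : continuous g -> open (g @^-1` [set` `]x, y[]).
  by move=> cg; apply: open_comp; [move=> *; exact: cg|exact: interval_open].
suff -> : f @` hexagon false =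
    ((u @^-1` [set` `]0, psi[]) `&` (w @^-1` [set` `]0, tau[])) `|`
    ((u @^-1` [set` `]0, psi * tau[]) `&` (w @^-1` [set` `]0, 1[])).
  by apply: openU; apply: openI; exact: ou.
apply/seteqP; split => z.
  move=> [[x y] + <-] /=; rewrite uf wf /hexagon /= !in_itv /=.
  have /andP[? ?] := @tau_bounds R.
  move=> [|[? /andP[? ?]]]; [by left|right; split => //; apply/andP; split => //; lra].
rewrite /= !in_itv /= => h; exists (u z, w z) => //; rewrite /hexagon /= !in_itv /=.
have := @psi_gt0 R; have /andP[? ?] := @tau_bounds R => s0.
case: h => -[/andP[? ?] /andP[? ?]].
  by left; split; apply/andP.
have [yt|yt] := ltP (w z) tau; [left|right]; split; apply/andP; split => //; nra.
Qed.

(** The open hexagons inside the tiles are disjoint and of full area, so finite sums of tile areas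
    stay below [M]. As every tile has area at least [d ^+ 2 * alpha * tau], there are finitely many,
    and subadditivity gives the reverse inequality. [m] and [n] arise as the numbers of large and
    small tiles. *)
Lemma tiling_area (d : R) T (X : set mplane) (M : R) :
  d_tiling d T -> tiles T X -> measurable X -> area X = M%:E ->
  exists m n : nat, M = d ^+ 2 * alpha * (m%:R + n%:R * tau).
Proof.
move=> [d0 _ tT triv] TX mX aX.
have s0 := @psi_gt0 R; have /andP[t1 t2] := @tau_bounds R.
have al0 : 0 < alpha by rewrite /bee_area; apply: mulr_gt0; [apply: mulr_gt0 => //|]; lra.
have da0 : 0 < d ^+ 2 * alpha by rewrite mulr_gt0 ?exprn_gt0.
have tile A : T A -> exists U : set mplane, [/\ U `<=` interior A, measurable U,
    measurable (A : set mplane), area U = area A &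
    exists m n : nat, area A = (d ^+ 2 * alpha * (m%:R + n%:R * tau))%:E /\ (0 < m + n)%N].
  have aux r f : similarity r f -> A = f @` @bee R -> [/\ f @` hexagon false `<=` interior A,
     measurable (f @` hexagon false : set mplane), measurable (A : set mplane),
     area (f @` hexagon false) = area A & area A = (r ^+ 2 * alpha)%:E].
    move=> fs ->; rewrite -hexagon_bee.
    have [m1 a1] := similarity_image_area false fs.
    have [m2 a2] := similarity_image_area true fs.
    split; rewrite ?a1 ?a2// -open_subsetE; last exact: (open_image_hexagon fs).
    by apply: image_subset; exact: hexagon_sub.
  case/tT => -[f fs fE]; have [h1 h2 h3 h4 h5] := aux _ _ fs fE; exists (f @` hexagon false); split => //.
    by exists 1%N, 0%N; rewrite h5 mul0r addr0 mulr1.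
  exists 0%N, 1%N; rewrite h5 exprMn psi_sqr add0r mul1r; split => //.
  by congr (_%:E); ring.
have {tile}[U UP] : exists U : set (plane R) -> set mplane, forall A, T A ->
    [/\ U A `<=` interior A, measurable (U A), measurable (A : set mplane), area (U A) = area A &
    exists m n : nat, area A = (d ^+ 2 * alpha * (m%:R + n%:R * tau))%:E /\ (0 < m + n)%N].
  have /choice[U UP] : forall A, exists U : set mplane, T A -> [/\ U `<=` interior A, measurable U,
    measurable (A : set mplane), area U = area A &
    exists m n : nat, area A = (d ^+ 2 * alpha * (m%:R + n%:R * tau))%:E /\ (0 < m + n)%N].
    by move=> A; have [/tile[U ?]|?] := pselect (T A); [exists U|exists set0].
  by exists U.
have trivU D : D `<=` T -> trivIset D U.
  move=> DT A B DA DB [z [zA zB]]; apply: triv; [exact: DT|exact: DT|].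
  have [hA _ _ _ _] := UP _ (DT _ DA); have [hB _ _ _ _] := UP _ (DT _ DB).
  by exists z; split; [exact: hA|exact: hB].
have UX A : T A -> U A `<=` X.
  move=> TA; have [h _ _ _ _] := UP _ TA; rewrite -TX.
  by apply: (subset_trans h); apply: (subset_trans (@interior_subset _ _)); exact: bigcup_sup.
have sumU D : finite_set D -> D `<=` T -> (\sum_(A \in D) area A <= M%:E)%E.
  move=> fD DT; rewrite -aX.
  rewrite (eq_fsbigr (fun A => area (U A))); last first.
    by move=> A /set_mem /DT /UP[].
  rewrite -measure_fin_bigcup//; last 2 first.
  - exact: trivU.
  - by move=> A /DT /UP[].
  apply: le_measure; rewrite ?inE//.
    by apply: fin_bigcup_measurable => // A /DT /UP[].
  by apply: bigcup_sub => A /DT; exact: UX.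
have area_ge A : T A -> ((d ^+ 2 * alpha * tau)%:E <= area A)%E.
  move=> /UP[_ _ _ _ [m [n [-> mn]]]]; rewrite lee_fin ler_pM2l//.
  have : 0 <= m%:R * (1 - tau) :> R by rewrite mulr_ge0 // ; lra.
  have : (1 <= m%:R + n%:R :> R) by rewrite -natrD ler1n.
  by nra.
have finT : finite_set T.
  apply: contrapT => /infinite_set_fset infT.
  have c0 : 0 < d ^+ 2 * alpha * tau by rewrite mulr_gt0//; lra.
  have [D DT cD] := infT (Num.truncn (M / (d ^+ 2 * alpha * tau))).+1.
  have /sumU := finite_fset D => /(_ DT).
  rewrite -fsbig_seq// leNgt => /negP; apply.
  change (M%:E < \sum_(A <- finmap.enum_fset D) area A)%E.
  apply: (@lt_le_trans _ _ (\sum_(A <- finmap.enum_fset D) (d ^+ 2 * alpha * tau)%:E)%E); last first.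
    rewrite big_seq [leRHS]big_seq; apply: lee_sum => A AD; apply: area_ge.
    exact: DT.
  rewrite sumEFin lte_fin big_const_seq count_predT iter_addr_0 -mulr_natr -ltr_pdivrMl//.
  rewrite mulrC; apply: (lt_le_trans (truncnS_gt _)).
  by rewrite ler_nat.
have e : M%:E = (\sum_(A \in T) area A)%E.
  apply/eqP; rewrite eq_le sumU // andbT -aX.
  apply: content_sub_fsum => //; first by move=> A /UP[].
  by rewrite -TX.
have : exists m n : nat, (\sum_(A \in T) area A)%E = (d ^+ 2 * alpha * (m%:R + n%:R * tau))%:E.
  rewrite fsbig_finite// big_seq.
  apply: (big_ind (fun x : \bar R => exists m n : nat, x = (d ^+ 2 * alpha * (m%:R + n%:R * tau))%:E)).
  - by exists 0%N, 0%N; rewrite mul0r addr0 mulr0.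
  - move=> _ _ [m [n ->]] [m' [n' ->]]; exists (m + m')%N, (n + n')%N.
    by apply: (congr1 EFin (x := _ + _)); rewrite !natrD; ring.
  - move=> A; rewrite in_fset_set// => /set_mem /UP[_ _ _ _ [m [n [-> _]]]].
    by exists m, n.
by rewrite -e => -[m [n [->]]]; exists m, n.
Qed.

End TilingArea.

(** * The substitution *)

(* [(a, b)] stands for [a + b * tau]. *)
Definition zt := (int * int)%type.

(* Only a sufficient condition: it uses no more than 8/13 < tau < 13/21. *)
Definition zpos (z : zt) : bool :=
  if 0 <= z.2 then 0 < 13 * z.1 + 8 * z.2 else 0 < 21 * z.1 + 13 * z.2.
Definition zlt (x y : zt) : bool := zpos (y - x).
Definition zle (x y : zt) : bool := (x == y) || zlt x y.

(* Multiplication by [1 + tau], the inverse of [tau]. *)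
Definition zmul_inv (z : zt) : zt := (z.1 + z.2, z.1).
Definition zmul_tau (z : zt) : zt := (z.2, z.1 - z.2).
Definition zsg (b : bool) (z : zt) : zt := if b then - z else z.

(* [(x, y)] stands for the point [(psi * x, y)] of the plane; in these
   coordinates all vertices of the tilings below lie in Z[tau]. *)
Definition zpt := (zt * zt)%type.
(* [((x0, x1), (y0, y1))] is the rectangle [x0, x1] x [y0, y1]. *)
Definition zrect := (zpt * zpt)%type.
Definition zarrow := (zpt * zpt * nat)%type.

Definition zpt_inv (p : zpt) : zpt := (zmul_inv p.1, zmul_inv p.2).
Definition zpt_flip (f : bool * bool) (p : zpt) : zpt := (zsg f.1 p.1, zsg f.2 p.2).

Definition zitv_place (b : bool) (o : zt) (i : zt * zt) : zt * zt :=
  if b then (o - i.2, o - i.1) else (o + i.1, o + i.2).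
Definition zrect_place (f : bool * bool) (o : zpt) (r : zrect) : zrect :=
  (zitv_place f.1 o.1 r.1, zitv_place f.2 o.2 r.2).
Definition zpt_place (f : bool * bool) (o p : zpt) : zpt := o + zpt_flip f p.
Definition zarrow_place (f : bool * bool) (o : zpt) (a : zarrow) : zarrow :=
  (zpt_place f o a.1.1, zpt_place f o a.1.2, a.2).

(* The first component tells holes from tiles. Small tiles have their axes
   exchanged, and the two sorts of holes alternate under the substitution. *)
Definition kind := (bool * bool)%type.
Local Notation KL := (false, false).
Local Notation KS := (false, true).
Local Notation KH := (true, false).
Local Notation KH' := (true, true).

Definition z0 : zt := (0, 0).
Definition z1 : zt := (1, 0).
Definition zT : zt := (0, 1).
(** [zT2] and [zT3] are the square and the cube of [tau]. *)
Definition zT2 : zt := (1, - 1).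
Definition zT3 : zt := (- 1, 2).

Definition base_rects (k : kind) : seq zrect :=
  match k with
  | KL => [:: ((z0, z1), (z0, zT)); ((z0, zT), (z0, z1))]
  | KS => [:: ((z0, zT), (z0, zT)); ((z0, z1), (z0, zT2))]
  | KH => [:: ((- zT, zT), (- zT2, zT2))]
  | KH' => [:: ((- zT2, zT2), (- zT3, zT3))]
  end.

(** Vertical sides point to their midpoints, horizontal ones away from them. In both uses [psi * u]
    is [psi ^+ i] and [v] is [psi ^+ j], so the lengths fit the colours. *)
Definition hole_arrows (u v : zt) (i j : nat) : seq zarrow :=
  [:: ((u, v), (u, z0), j); ((u, - v), (u, z0), j);
      ((- u, v), (- u, z0), j); ((- u, - v), (- u, z0), j);
      ((z0, v), (u, v), i); ((z0, v), (- u, v), i);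
      ((z0, - v), (u, - v), i); ((z0, - v), (- u, - v), i)].

Definition base_arrows (k : kind) : seq zarrow :=
  match k with
  | KL =>
  [:: ((z0, z0), (z0, zT2), 4%N);
      ((z0, zT2 + zT2), (z0, zT2), 4%N);
      ((z0, z1), (z0, zT2 + zT2), 6%N);
      ((z1, z0), (zT, z0), 5%N);
      ((zT, z0), (z0, z0), 3%N);
      ((z1, zT), (z1, zT2), 6%N);
      ((z1, zT2), (z1, z0), 4%N);
      ((zT, zT), (z1, zT), 5%N);
      ((zT, z1), (zT, zT), 4%N);
      ((z0, z1), (zT, z1), 3%N)]
  | KS =>
  [:: ((z0, z0), (zT2, z0), 5%N);
      ((zT2, z0), (z1, z0), 3%N);
      ((z0, zT), (z0, zT2), 6%N);
      ((z0, zT2), (z0, z0), 4%N);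
      ((z0, zT), (zT, zT), 3%N);
      ((zT, zT2), (zT, zT), 6%N);
      ((z1, zT2), (zT, zT2), 5%N);
      ((z1, z0), (z1, zT2), 4%N)]
  | KH => hole_arrows zT zT2 3 4
  | KH' => hole_arrows zT2 zT3 5 6
  end.

Definition zS : zt := (1, 1).

(* Two successive dissections of a bee, with the coordinates multiplied by
   [1 + tau] so that the pieces have the original sizes. *)
Definition base_children (k : kind) : seq (kind * (bool * bool) * zpt) :=
  match k with
  | KL => [:: (KL, (true, true), (zS, z1)); (KS, (false, false), (z0, z0));
              (KL, (false, true), (z0, zS))]
  | KS => [:: (KL, (false, true), (z0, z1)); (KS, (true, false), (zS, z0))]
  | KH => [:: (KS, (true, true), (z1, zT)); (KS, (true, false), (z1, - zT));
              (KS, (false, true), (- z1, zT)); (KS, (false, false), (- z1, - zT));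
              (KH', (false, false), (z0, z0))]
  | KH' => [:: (KH, (false, false), (z0, z0))]
  end.

Definition proto := (kind * (bool * bool))%type.
Definition placed := (proto * zpt)%type.

Definition rects (z : placed) : seq zrect :=
  map (zrect_place z.1.2 z.2) (base_rects z.1.1).
Definition arrows (z : placed) : seq zarrow :=
  map (zarrow_place z.1.2 z.2) (base_arrows z.1.1).
Definition children (z : placed) : seq placed :=
  [seq ((c.1.1, (z.1.2.1 (+) c.1.2.1, z.1.2.2 (+) c.1.2.2)),
        zpt_inv z.2 + zpt_flip z.1.2 c.2) | c <- base_children z.1.1].

Fixpoint tile_patch (n : nat) : seq placed :=
  if n is n'.+1 then flatten (map children (tile_patch n'))
  else [:: ((KH, (false, false)), (z0, z0))].

(** Colours 3 and 4 are cut in golden ratio, the longer piece at the start, and both pieces run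
    against their parent; colours 5 and 6 keep their direction. *)
Definition sub_arrows (a : zarrow) : seq zarrow :=
  let s := zpt_inv a.1.1 in let e := zpt_inv a.1.2 in
  let m := s + (zmul_tau (e.1 - s.1), zmul_tau (e.2 - s.2)) in
  if (a.2 <= 4)%N then [:: (m, s, a.2); (e, m, (a.2).+2)] else [:: (s, e, (a.2 - 2)%N)].

Definition zsub_rect (r r' : zrect) : bool :=
  [&& zle r'.1.1 r.1.1, zle r.1.2 r'.1.2, zle r'.2.1 r.2.1 & zle r.2.2 r'.2.2].
Definition zsep (r r' : zrect) : bool :=
  [|| zle r.1.2 r'.1.1, zle r'.1.2 r.1.1, zle r.2.2 r'.2.1 | zle r'.2.2 r.2.1].
Definition zscale_rect (r : zrect) : zrect :=
  ((zmul_inv r.1.1, zmul_inv r.1.2), (zmul_inv r.2.1, zmul_inv r.2.2)).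
Definition zbox (a : zarrow) : zrect :=
  let s (u v : zt) := if zle u v then (u, v) else (v, u) in
  (s a.1.1.1 a.1.2.1, s a.1.1.2 a.1.2.2).
Definition zin_rect (a : zarrow) (r : zrect) : bool :=
  [&& zle r.1.1 a.1.1.1, zle a.1.1.1 r.1.2, zle r.2.1 a.1.1.2, zle a.1.1.2 r.2.2,
      zle r.1.1 a.1.2.1, zle a.1.2.1 r.1.2, zle r.2.1 a.1.2.2 & zle a.1.2.2 r.2.2].
Definition zdisj (i j : zt * zt) : bool := zlt i.2 j.1 || zlt j.2 i.1.
(* In each disjunct, two intervals have at most one common point. *)
Definition zdeg (i j : zt * zt) : bool :=
  [|| zle i.2 j.1, zle j.2 i.1, zle i.2 i.1 | zle j.2 j.1].
(** [zbox] sorts coordinates by [zle], which may miss a true inequality; that each box contains its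
    arrow is therefore tested as well. *)
Definition zsep_arrow (a b : zarrow) : bool :=
  let r := zbox a in let s := zbox b in
  [&& zin_rect a r, zin_rect b s &
    [|| zdisj r.1 s.1, zdisj r.2 s.2 | zdeg r.1 s.1 && zdeg r.2 s.2]].
(* The arrow runs through the interior of the rectangle, up to its endpoints. *)
Definition zinner (a : zarrow) (r : zrect) : bool :=
  zin_rect a r &&
  ((a.1.1.1 == a.1.2.1) && zlt r.1.1 a.1.1.1 && zlt a.1.1.1 r.1.2 ||
   (a.1.1.2 == a.1.2.2) && zlt r.2.1 a.1.1.2 && zlt a.1.1.2 r.2.2).

Definition origin (p : proto) : placed := (p, (z0, z0)).
Definition bool_pairs : seq (bool * bool) :=
  allpairs pair [:: true; false] [:: true; false].
Definition protos : seq proto := allpairs pair bool_pairs bool_pairs.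

(** * Finite checks on pieces *)

Definition check_own (z : placed) : bool :=
  all (fun a => has (zin_rect a) (rects z)) (arrows z).
Definition check_rects (z : placed) : bool :=
  all (fun c => all (fun r => has (fun r' => zsub_rect r (zscale_rect r')) (rects z)) (rects c))
    (children z).
Definition check_sep (z : placed) : bool :=
  all (fun c => all (fun c' => (c == c') ||
    all (fun r => all (zsep r) (rects c')) (rects c) &&
    all (fun a => all (fun b => (a == b) || zsep_arrow a b) (arrows c')) (arrows c))
    (children z)) (children z).
Definition check_arrows (z : placed) : bool :=
  all (fun c => all (fun a => has (fun e => a \in sub_arrows e) (arrows z) ||
    has (fun r => zinner a (zscale_rect r)) (rects z)) (arrows c)) (children z).
Definition check_sub (z : placed) : bool :=
  all (fun e => all (fun a => all (fun b => (a == b) || zsep_arrow a b) (sub_arrows e))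
    (sub_arrows e)) (arrows z).

(** Covering is tested on a grid: the side coordinates of the children cut the parent rectangle into
    cells, each of which must lie in one rectangle of a child. *)
Definition cuts (i : zt * zt) (l : seq (zt * zt)) : seq zt :=
  rcons (sort zle [seq x <- flatten [seq [:: j.1; j.2] | j <- l] | zlt i.1 x && zlt x i.2]) i.2.
Definition steps (x : zt) (s : seq zt) : seq (zt * zt) := zip (x :: s) s.
Definition check_cover (z : placed) : bool :=
  let l := flatten (map rects (children z)) in
  all (fun r0 => let r := zscale_rect r0 in
    all (fun i => all (fun j => has (zsub_rect (i, j)) l)
      (steps r.2.1 (cuts r.2 (map snd l)))) (steps r.1.1 (cuts r.1 (map fst l)))) (rects z).

Definition check_hole (z : placed) : bool :=
  all (fun c => c.1.1.1 ==> z.1.1.1 && (c.2 == (z0, z0))) (children z) &&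
  (z.1.1.1 ==> all (fun r => zsub_rect r ((- zT, zT), (- zT2, zT2))) (rects z)).

Definition check_all (z : placed) : bool :=
  [&& check_own z, check_rects z, check_sep z, check_arrows z, check_sub z, check_cover z &
    check_hole z].

Lemma all_protosP (P : pred proto) : all P protos -> forall p, P p.
Proof.
move=> /allP h [k f]; apply: h; apply: allpairs_f; rewrite /bool_pairs;
by case: k => -[] []; case: f => -[] [].
Qed.

(** The geometry of the dissections is verified here by computation, for four kinds in four
    orientations at the origin. *)
Lemma protos_checked (p : proto) : check_all (origin p).
Proof. by move: p; apply: (@all_protosP (fun p => check_all (origin p))); vm_compute. Qed.

(** * Translation invariance of the checks *)

Lemma zmul_invD : {morph zmul_inv : x y / x + y >-> x + y}.
Proof. by move=> [a b] [c d]; congr (_, _) => /=; rewrite addrACA. Qed.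

Lemma zpt_invD p q : zpt_inv (p + q) = zpt_inv p + zpt_inv q.
Proof. by case: p q => [a b] [c d]; rewrite /zpt_inv /= !zmul_invD. Qed.

Definition shift_rect (o : zpt) (r : zrect) : zrect :=
  ((o.1 + r.1.1, o.1 + r.1.2), (o.2 + r.2.1, o.2 + r.2.2)).
Definition shift_arrow (o : zpt) (a : zarrow) : zarrow := (o + a.1.1, o + a.1.2, a.2).
Definition shift_tile (o : zpt) (z : placed) : placed := (z.1, o + z.2).

Lemma shift_origin z : z = shift_tile z.2 (origin z.1).
Proof. by case: z => p o; rewrite /shift_tile /origin /= addr0. Qed.

Lemma rects_shift o z : rects (shift_tile o z) = map (shift_rect o) (rects z).
Proof.
rewrite /rects -map_comp; apply: eq_map => -[[a b] [c d]] /=.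
by rewrite /zrect_place /shift_rect /=; case: (z.1.2) => -[] [] /=; rewrite !addrA.
Qed.

Lemma arrows_shift o z : arrows (shift_tile o z) = map (shift_arrow o) (arrows z).
Proof.
rewrite /arrows -map_comp; apply: eq_map => -[[a b] c] /=.
by rewrite /zarrow_place /shift_arrow /zpt_place /= !addrA.
Qed.

Lemma children_shift o z : children (shift_tile o z) = map (shift_tile (zpt_inv o)) (children z).
Proof.
rewrite /children -map_comp; apply: eq_map => c /=.
by rewrite /shift_tile /= zpt_invD addrA.
Qed.

Lemma sub_arrows_shift o a :
  sub_arrows (shift_arrow o a) = map (shift_arrow (zpt_inv o)) (sub_arrows a).
Proof.
case: a => [[s e] c]; rewrite /sub_arrows /=.
have zD (x y z : zt) : zmul_inv (x + y) - zmul_inv (x + z) = zmul_inv y - zmul_inv z.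
  by rewrite !zmul_invD opprD addrACA subrr add0r.
rewrite !zpt_invD; case: ifP => _ //=.
rewrite /shift_arrow /= -!addrA; congr [:: (_, _, _); (_, _, _)]; congr (_ + (_ + _));
by congr (_, _); rewrite zmul_invD [X in _ - X]zmul_invD opprD addrACA subrr add0r.
Qed.

Lemma zlt_shift o x y : zlt (o + x) (o + y) = zlt x y.
Proof. by rewrite /zlt opprD addrACA subrr add0r. Qed.

Lemma zle_shift o x y : zle (o + x) (o + y) = zle x y.
Proof. by rewrite /zle zlt_shift (inj_eq (addrI o)). Qed.

Definition zshiftE := (zle_shift, zlt_shift).

Lemma zscale_rect_shift o r : zscale_rect (shift_rect o r) = shift_rect (zpt_inv o) (zscale_rect r).
Proof. by rewrite /zscale_rect /shift_rect /= !zmul_invD. Qed.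

Lemma shift_arrow_inj o : injective (shift_arrow o).
Proof.
move=> [[a b] c] [[a' b'] c'] h; congr (_, _, _); last exact: (congr1 snd h).
  by apply: (addrI o); exact: (congr1 (fun x => x.1.1) h).
by apply: (addrI o); exact: (congr1 (fun x => x.1.2) h).
Qed.

Lemma shift_inj o : injective (shift_tile o).
Proof.
move=> [p a] [q b] h; congr (_, _); first exact: (congr1 fst h).
by apply: (addrI o); exact: (congr1 snd h).
Qed.

Lemma zsub_rect_shift o r s : zsub_rect (shift_rect o r) (shift_rect o s) = zsub_rect r s.
Proof. by rewrite /zsub_rect /= !zshiftE. Qed.

Lemma zsep_shift o r s : zsep (shift_rect o r) (shift_rect o s) = zsep r s.
Proof. by rewrite /zsep /= !zshiftE. Qed.

Lemma zin_rect_shift o a r : zin_rect (shift_arrow o a) (shift_rect o r) = zin_rect a r.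
Proof. by case: o => o1 o2; rewrite /zin_rect /= !zshiftE. Qed.

Lemma zbox_shift o a : zbox (shift_arrow o a) = shift_rect o (zbox a).
Proof.
by case: o => o1 o2; rewrite /zbox /shift_rect /= !zshiftE; do 2 case: ifP => _.
Qed.

Lemma zsep_arrow_shift o a b : zsep_arrow (shift_arrow o a) (shift_arrow o b) = zsep_arrow a b.
Proof. by rewrite /zsep_arrow !zbox_shift !zin_rect_shift /zdisj /zdeg /= !zshiftE. Qed.

Lemma zinner_shift o a r : zinner (shift_arrow o a) (shift_rect o r) = zinner a r.
Proof.
rewrite /zinner zin_rect_shift; case: o => o1 o2 /=.
by rewrite !zshiftE !(inj_eq (addrI _)).
Qed.

Lemma check_own_shift o z : check_own (shift_tile o z) = check_own z.
Proof.
rewrite /check_own arrows_shift all_map; apply: eq_all => a /=.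
by rewrite rects_shift has_map; apply: eq_has => r; exact: zin_rect_shift.
Qed.

Lemma check_rects_shift o z : check_rects (shift_tile o z) = check_rects z.
Proof.
rewrite /check_rects children_shift all_map; apply: eq_all => c /=.
rewrite !rects_shift all_map; apply: eq_all => r /=.
rewrite has_map; apply: eq_has => s /=.
by rewrite zscale_rect_shift zsub_rect_shift.
Qed.

Lemma check_sep_shift o z : check_sep (shift_tile o z) = check_sep z.
Proof.
rewrite /check_sep children_shift all_map; apply: eq_all => c /=.
rewrite all_map; apply: eq_all => d /=.
rewrite (inj_eq (@shift_inj _)) !rects_shift !arrows_shift !all_map.
congr (_ || (_ && _)).
  by apply: eq_all => r /=; rewrite all_map; apply: eq_all => s; exact: zsep_shift.
apply: eq_all => a /=; rewrite all_map; apply: eq_all => b /=.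
by rewrite (inj_eq (@shift_arrow_inj _)) zsep_arrow_shift.
Qed.

Lemma check_arrows_shift o z : check_arrows (shift_tile o z) = check_arrows z.
Proof.
rewrite /check_arrows children_shift all_map; apply: eq_all => c /=.
rewrite !arrows_shift rects_shift all_map; apply: eq_all => a /=.
rewrite !has_map; congr (_ || _); apply: eq_has => e /=.
  by rewrite sub_arrows_shift (mem_map (@shift_arrow_inj _)).
by rewrite zscale_rect_shift zinner_shift.
Qed.

Lemma check_sub_shift o z : check_sub (shift_tile o z) = check_sub z.
Proof.
rewrite /check_sub arrows_shift all_map; apply: eq_all => e /=.
rewrite sub_arrows_shift all_map; apply: eq_all => a /=.
rewrite all_map; apply: eq_all => b /=.
by rewrite (inj_eq (@shift_arrow_inj _)) zsep_arrow_shift.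
Qed.

(** The two remaining checks are applied at the origin: the one on holes depends on the position,
    and the covering is translated later, after evaluation in the reals. *)
Lemma placed_checked z :
  [/\ check_own z, check_rects z, check_sep z, check_arrows z & check_sub z].
Proof.
rewrite (shift_origin z) check_own_shift check_rects_shift check_sep_shift.
rewrite check_arrows_shift check_sub_shift.
by have /and5P[-> -> -> -> /and3P[->]] := protos_checked z.1.
Qed.

(** * Evaluation of Z[tau] in the reals *)

Section Eval.
Variable R : realType.
Local Notation tau := (tau R).

Definition zeval (z : zt) : R := z.1%:~R + z.2%:~R * tau.
Definition zeval_pt (p : zpt) : plane R := (zeval p.1, zeval p.2).

Lemma evD x y : zeval (x + y) = zeval x + zeval y.
Proof. by rewrite /zeval /= !intrD; ring. Qed.

Lemma evN x : zeval (- x) = - zeval x.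
Proof. by rewrite /zeval /= !intrN; ring. Qed.

Lemma ev_zmul_inv z : zeval (zmul_inv z) = (1 + tau) * zeval z.
Proof.
have e := @tau_sqr R; rewrite /zeval /= intrD.
rewrite [RHS](_ : _ = z.1%:~R + z.2%:~R * (tau + tau ^+ 2) + z.1%:~R * tau); last by ring.
by rewrite e; ring.
Qed.

Lemma ev_zmul_tau z : zeval (zmul_tau z) = tau * zeval z.
Proof.
have e := @tau_sqr R; rewrite /zeval /= intrB.
rewrite [RHS](_ : _ = z.1%:~R * tau + z.2%:~R * tau ^+ 2); last by ring.
by rewrite e; ring.
Qed.

Lemma ev_z0 : zeval z0 = 0. Proof. by rewrite /zeval /= mul0r addr0. Qed.
Lemma ev_z1 : zeval z1 = 1. Proof. by rewrite /zeval /= mul0r addr0. Qed.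
Lemma ev_zT : zeval zT = tau. Proof. by rewrite /zeval /= mul1r add0r. Qed.
Lemma ev_zT2 : zeval zT2 = 1 - tau. Proof. by rewrite /zeval /= mulrN1z mulN1r. Qed.

Lemma ev_zlt x y : zlt x y -> zeval x < zeval y.
Proof.
rewrite /zlt -subr_gt0 -evN -evD; move: (y - x) => -[a b] {x y}.
have /andP[t1 t2] := @tau_bounds R.
rewrite /zpos /zeval /=; case: ifP => [b0|/negbT].
  rewrite -(ltr0z R) rmorphD !rmorphM /= !rmorph_nat => h.
  have : 0 <= b%:~R :> R by rewrite ler0z.
  by move: h; nra.
rewrite -ltNge -(ltrz0 R) -(ltr0z R) rmorphD !rmorphM /= !rmorph_nat => h.
by nra.
Qed.

Lemma ev_zle x y : zle x y -> zeval x <= zeval y.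
Proof. by move=> /orP[/eqP -> //|/ev_zlt/ltW]. Qed.
End Eval.

(** * Geometry of the patches *)

Section Patch.
Variable R : realType.
Local Notation tau := (tau R).
Local Notation ev := (@zeval R).
Local Notation evp := (@zeval_pt R).

Lemma segmentP (P Q p : plane R) : segment P Q p <->
  exists s, [/\ 0 <= s <= 1, p.1 = P.1 + s * (Q.1 - P.1) & p.2 = P.2 + s * (Q.2 - P.2)].
Proof.
split=> [[s]|[s [s01 e1 e2]]].
  by rewrite /= in_itv /= => s01 <-; exists s.
by exists s => //; rewrite [p]surjective_pairing e1 e2.
Qed.

Lemma lerp_le (a b x y s : R) : 0 <= s <= 1 -> a <= x -> a <= y -> x <= b -> y <= b ->
  a <= x + s * (y - x) <= b.
Proof. by move=> /andP[? ?] *; apply/andP; split; nra. Qed.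

Definition aseg (a : zarrow) : set (plane R) := segment (evp a.1.1) (evp a.1.2).
Definition in_rect (r : zrect) (q : plane R) : Prop :=
  ev r.1.1 <= q.1 <= ev r.1.2 /\ ev r.2.1 <= q.2 <= ev r.2.2.
Definition separated (r r' : zrect) : Prop :=
  [\/ ev r.1.2 <= ev r'.1.1, ev r'.1.2 <= ev r.1.1,
      ev r.2.2 <= ev r'.2.1 | ev r'.2.2 <= ev r.2.1].
Definition meet_once (a b : zarrow) : Prop :=
  forall p q, aseg a p -> aseg b p -> aseg a q -> aseg b q -> p = q.
Definition inflate (q : plane R) : plane R := ((1 + tau) * q.1, (1 + tau) * q.2).

Lemma itau_gt0 : 0 < 1 + tau.
Proof. by have /andP[? ?] := @tau_bounds R; lra. Qed.

Lemma zin_rectP a r p : zin_rect a r -> aseg a p -> in_rect r p.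
Proof.
move=> /and5P[h1 h2 h3 h4 /and4P[h5 h6 h7 h8]] /segmentP[s [s01 e1 e2]].
by rewrite /in_rect e1 e2; split; apply: lerp_le => //; exact: ev_zle.
Qed.

Lemma zdisjP i j (x : R) : zdisj i j -> ev i.1 <= x <= ev i.2 -> ev j.1 <= x <= ev j.2 -> False.
Proof. by move=> /orP[]/(@ev_zlt R) ? /andP[? ?] /andP[? ?]; lra. Qed.

Lemma zdegP i j (x y : R) : zdeg i j ->
  ev i.1 <= x <= ev i.2 -> ev j.1 <= x <= ev j.2 ->
  ev i.1 <= y <= ev i.2 -> ev j.1 <= y <= ev j.2 -> x = y.
Proof.
by move=> /or4P[]/(@ev_zle R) ? /andP[? ?] /andP[? ?] /andP[? ?] /andP[? ?]; lra.
Qed.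

Lemma zsep_arrowP a b : zsep_arrow a b -> meet_once a b.
Proof.
move=> /and3P[ia ib h] p q ap bp aq bq.
have [ap1 ap2] := zin_rectP ia ap; have [aq1 aq2] := zin_rectP ia aq.
have [bp1 bp2] := zin_rectP ib bp; have [bq1 bq2] := zin_rectP ib bq.
case/or3P: h => [/zdisjP h|/zdisjP h|/andP[/zdegP h1 /zdegP h2]].
- by case: (h _ ap1 bp1).
- by case: (h _ ap2 bp2).
by rewrite [p]surjective_pairing [q]surjective_pairing (h1 p.1 q.1) // (h2 p.2 q.2).
Qed.

(** The midpoint is taken because the ends of the arrow may lie on the boundary: across the arrow
    strictness is part of the check, along it strictness comes from [p <> q]. *)
Lemma zinnerP a r p q : zinner a r -> aseg a p -> aseg a q -> p <> q ->
  ev r.1.1 < (p.1 + q.1) / 2 < ev r.1.2 /\ ev r.2.1 < (p.2 + q.2) / 2 < ev r.2.2.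
Proof.
move=> /andP[iar h] ap aq pq.
have [/andP[p1 p2] /andP[p3 p4]] := zin_rectP iar ap.
have [/andP[q1 q2] /andP[q3 q4]] := zin_rectP iar aq.
have pq' : p.1 <> q.1 \/ p.2 <> q.2.
  apply: contrapT => /not_orP[/contrapT e1 /contrapT e2]; apply: pq.
  by rewrite [p]surjective_pairing e1 e2 -surjective_pairing.
move: ap aq => /segmentP[s [s01 e1 e2]] /segmentP[s' [s01' e1' e2']].
case/orP: h => /andP[/andP[/eqP ea /(@ev_zlt R) h1] /(@ev_zlt R) h2].
  have e : p.1 = ev a.1.1.1 by rewrite e1 /= ea subrr mulr0 addr0.
  have e' : q.1 = ev a.1.1.1 by rewrite e1' /= ea subrr mulr0 addr0.
  have : p.2 != q.2 by apply/eqP; case: pq' => //; rewrite e e'.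
  by rewrite neq_lt => /orP[] ?; split; apply/andP; split; lra.
have e : p.2 = ev a.1.1.2 by rewrite e2 /= ea subrr mulr0 addr0.
have e' : q.2 = ev a.1.1.2 by rewrite e2' /= ea subrr mulr0 addr0.
have : p.1 != q.1 by apply/eqP; case: pq' => //; rewrite e e'.
by rewrite neq_lt => /orP[] ?; split; apply/andP; split; lra.
Qed.

Lemma in_zscale_rect r p : in_rect (zscale_rect r) (inflate p) <-> in_rect r p.
Proof. by rewrite /in_rect /= !ev_zmul_inv !(ler_pM2l itau_gt0). Qed.

Lemma sub_arrowsP e a p : a \in sub_arrows e -> aseg a p ->
  exists2 q, aseg e q & p = inflate q.
Proof.
have /andP[t1 t2] := @tau_bounds R.
move=> ae /segmentP[s [/andP[s0 s1] p1 p2]].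
suff [u [u01 a1 a2]] : exists u, [/\ 0 <= u <= 1,
    p.1 = (1 + tau) * (ev e.1.1.1 + u * (ev e.1.2.1 - ev e.1.1.1)) &
    p.2 = (1 + tau) * (ev e.1.1.2 + u * (ev e.1.2.2 - ev e.1.1.2))].
  pose q : plane R := (ev e.1.1.1 + u * (ev e.1.2.1 - ev e.1.1.1),
    ev e.1.1.2 + u * (ev e.1.2.2 - ev e.1.1.2)).
  exists q; first by apply/segmentP; exists u.
  by rewrite [p]surjective_pairing a1 a2.
move: ae p1 p2; rewrite /sub_arrows; case: ifP => _; rewrite !inE; last first.
  move=> /eqP -> /=; rewrite !ev_zmul_inv => -> ->.
  by exists s; split; [rewrite s0|ring|ring].
have evS x y : ev (zmul_tau (zmul_inv x - zmul_inv y)) = tau * (1 + tau) * (ev x - ev y).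
  by rewrite ev_zmul_tau evD evN !ev_zmul_inv; ring.
move=> /orP[]/eqP -> /=; rewrite !evD !evS !ev_zmul_inv => -> ->.
  by exists (tau * (1 - s)); split; [apply/andP; split; nra|ring|ring].
by exists (1 - s * (1 - tau)); split; [apply/andP; split; nra|ring|ring].
Qed.

Definition region (z : placed) : set (plane R) :=
  [set q | exists2 r, r \in rects z & in_rect r q].

(** The invariant of the induction. It also covers holes, whose arrows are handed down to tiles. *)
Definition compatible (z z' : placed) : Prop :=
  (forall r r', r \in rects z -> r' \in rects z' -> separated r r') /\
  (forall a b, a \in arrows z -> b \in arrows z' -> a = b \/ meet_once a b).

Lemma zsepP r r' : zsep r r' -> separated r r'.
Proof.
by case/or4P => /(@ev_zle R) h;
  [apply: Or41|apply: Or42|apply: Or43|apply: Or44].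
Qed.

Lemma zsub_rectP r r' : zsub_rect r r' ->
  [/\ ev r'.1.1 <= ev r.1.1, ev r.1.2 <= ev r'.1.2, ev r'.2.1 <= ev r.2.1 & ev r.2.2 <= ev r'.2.2].
Proof. by move=> /and4P[]; split; exact: ev_zle. Qed.

Lemma in_zsub_rect r r' p : zsub_rect r r' -> in_rect r p -> in_rect r' p.
Proof.
move=> /zsub_rectP[? ? ? ?] [/andP[? ?] /andP[? ?]].
by split; apply/andP; split; lra.
Qed.

Lemma child_rect z c r : c \in children z -> r \in rects c ->
  exists2 r', r' \in rects z & zsub_rect r (zscale_rect r').
Proof.
have [_ h _ _ _] := placed_checked z => cz rc.
by have /allP /(_ _ cz) /allP /(_ _ rc) /hasP := h.
Qed.

Lemma child_arrow_rect z c a : c \in children z -> a \in arrows c ->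
  exists2 r, r \in rects z & forall p, aseg a p -> in_rect (zscale_rect r) p.
Proof.
move=> cz ac; have [/allP /(_ _ ac) /hasP[r rc ar] _ _ _ _] := placed_checked c.
have [r' rz rr] := child_rect cz rc; exists r' => // p ap.
exact: (in_zsub_rect rr (zin_rectP ar ap)).
Qed.

(* The colours and directions along a common side agree before the
   substitution, so they agree afterwards; an arrow created inside a parent
   cannot be met by the arrows of the other parents. *)
Lemma compatible_children z z' c c' : (z <> z' -> compatible z z') -> (z' <> z -> compatible z' z) ->
  c \in children z -> c' \in children z' -> c <> c' -> compatible c c'.
Proof.
move=> zz' z'z cz cz' cc'.
have [ezz'|nzz'] := pselect (z = z').
  move: cz'; rewrite -ezz' => cz'; have [_ _ h _ _] := placed_checked z.
  have /allP /(_ _ cz) /allP /(_ _ cz') /orP[/eqP //|/andP[h1 h2]] := h.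
  split=> [r r' rc rc'|a b ac bc].
    by apply: zsepP; move/allP: h1 => /(_ _ rc) /allP /(_ _ rc').
  move/allP: h2 => /(_ _ ac) /allP /(_ _ bc) /orP[/eqP|/zsep_arrowP]; by [left|right].
have inner_arrow y y' d d' a b r : compatible y y' -> d \in children y -> d' \in children y' ->
    a \in arrows d -> b \in arrows d' -> r \in rects y -> zinner a (zscale_rect r) -> meet_once a b.
  move=> [yy' _] dy dy' ad bd ry ar p q ap bp aq bq; apply: contrapT => pq.
  have [r' ry' br'] := child_arrow_rect dy' bd.
  (* The midpoint of two common points would be interior to a rectangle of [y] and contained in one
     of [y'], but these are separated. *)
  have [/andP[m1 m2] /andP[m3 m4]] := zinnerP ar ap aq pq.
  have [/andP[p1 p2] /andP[p3 p4]] := br' _ bp; have [/andP[q1 q2] /andP[q3 q4]] := br' _ bq.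
  move: m1 m2 m3 m4 p1 p2 p3 p4 q1 q2 q3 q4; rewrite /= !ev_zmul_inv => *.
  have := itau_gt0.
  by case: (yy' _ _ ry ry') => h i0; have := h; rewrite -(ler_pM2l i0); lra.
have [comp1 comp2] := zz' nzz'.
split=> [r r' rc rc'|a b ac bc].
  have [s sz /zsub_rectP[rs1 rs2 rs3 rs4]] := child_rect cz rc.
  have [s' sz' /zsub_rectP[rs1' rs2' rs3' rs4']] := child_rect cz' rc'.
  move: rs1 rs2 rs3 rs4 rs1' rs2' rs3' rs4'; rewrite /= !ev_zmul_inv => *.
  have i0 := itau_gt0.
  case: (comp1 _ _ sz sz') => h; have := h; rewrite -(ler_pM2l i0) => h'.
  - by apply: Or41; lra.
  - by apply: Or42; lra.
  - by apply: Or43; lra.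
  - by apply: Or44; lra.
have [_ _ _ ha _] := placed_checked z.
have [_ _ _ hb hs] := placed_checked z'.
have /allP /(_ _ cz) /allP /(_ _ ac) /orP[/hasP[e ez ae]|/hasP[r rz ar]] := ha; last first.
  by right; exact: (inner_arrow z z' c c' a b r (zz' nzz') cz cz' ac bc rz ar).
have /allP /(_ _ cz') /allP /(_ _ bc) /orP[/hasP[e' ez' be]|/hasP[r rz br]] := hb; last first.
  right => p q ap bp aq bq.
  have z'z' : compatible z' z by apply: z'z => zz; exact: nzz'.
  exact: (inner_arrow z' z c' c b a r z'z' cz' cz bc ac rz br p q bp ap bq aq).
(* Pieces of one parent arrow are covered by [check_sub]; two common points of pieces of different
   ones would deflate to two common points of the parents. *)
have [ee'|me] := comp2 _ _ ez ez'.
  move: ae; rewrite ee' => ae.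
  by have /allP /(_ _ ez') /allP /(_ _ ae) /allP /(_ _ be) /orP[/eqP|/zsep_arrowP] := hs; [left|right].
right => p q ap bp aq bq.
have [p1 ep1 pE1] := sub_arrowsP ae ap; have [p2 ep2 pE2] := sub_arrowsP be bp.
have [q1 eq1 qE1] := sub_arrowsP ae aq; have [q2 eq2 qE2] := sub_arrowsP be bq.
have inj u v : inflate u = inflate v -> u = v.
  case: u v => [u1 u2] [v1 v2] [] /(mulfI (lt0r_neq0 itau_gt0)) -> /(mulfI (lt0r_neq0 itau_gt0)) -> //.
have ep : p1 = p2 by apply: inj; rewrite -pE1.
have eq : q1 = q2 by apply: inj; rewrite -qE1.
by rewrite pE1 qE1 (me p1 q1)// ?ep ?eq.
Qed.

Lemma patch_compatible n z z' : z \in tile_patch n -> z' \in tile_patch n -> z <> z' -> compatible z z'.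
Proof.
elim: n z z' => [|n IH] z z' /=.
  by rewrite !inE => /eqP -> /eqP ->.
move=> /flatten_mapP[y yn zy] /flatten_mapP[y' yn' zy'].
by apply: compatible_children zy zy' => ?; exact: IH.
Qed.

(** Only holes have holes among their children, and always at offset zero. *)
Lemma patch_hole n (z : placed) : z \in tile_patch n -> z.1.1.1 -> z.2 = (z0, z0).
Proof.
elim: n z => [|n IH] z /=; first by rewrite inE => /eqP ->.
move=> /flatten_mapP[y yn zy] hz.
have /and5P[_ _ _ _ /and3P[_ _ /andP[/allP h _]]] := protos_checked y.1.
move: zy; rewrite (shift_origin y) children_shift => /mapP[c cy zE].
move: hz; rewrite zE /= => hc; move: (h _ cy); rewrite hc /= => /andP[hy /eqP ->].
by rewrite (IH _ yn hy).
Qed.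

Lemma hole_region (z : placed) q : z.1.1.1 -> z.2 = (z0, z0) -> region z q ->
  - tau <= q.1 <= tau /\ - (1 - tau) <= q.2 <= 1 - tau.
Proof.
case: z => p o /= hp -> [r rp rq].
have /and5P[_ _ _ _ /and3P[_ _ /andP[_ /implyP/(_ hp)/allP h]]] := protos_checked p.
by have := in_zsub_rect (h _ rp) rq; rewrite /in_rect /= !evN ev_zT ev_zT2.
Qed.

(** The first entry of [s] that reaches [q] ends a step around [q], in whatever order the entries
    come. *)
Lemma steps_cover x s (q : R) : ev x <= q <= ev (last x s) -> s != [::] ->
  exists2 i, i \in steps x s & ev i.1 <= q <= ev i.2.
Proof.
elim: s x => // y s IH x /= /andP[xq qs] _.
have [qy|yq] := leP q (ev y).
  by exists (x, y); rewrite ?inE ?eqxx //= xq.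
case: s IH qs => [|w s] IH qs; first by move: qs yq => /= ? ?; exfalso; lra.
have [i iin iq] := IH y (introT andP (conj (ltW yq) qs)) isT.
by exists i => //; rewrite /steps /= inE iin orbT.
Qed.

Lemma region_children z q : region z q -> exists2 c, c \in children z & region c (inflate q).
Proof.
rewrite (shift_origin z); move: z.1 z.2 => p o [r].
rewrite rects_shift children_shift => /mapP[r0 r0p ->] rq.
pose q0 : plane R := (q.1 - ev o.1, q.2 - ev o.2).
have {rq} : in_rect r0 q0.
  move: rq; rewrite /in_rect /= !evD => -[/andP[? ?] /andP[? ?]].
  by split; apply/andP; split; lra.
have /and5P[_ _ _ _ /and3P[_ /allP/(_ _ r0p) h _]] := protos_checked p.
move/in_zscale_rect; move: h; set l := flatten _ => h [qx qy].
have cover (i : zt * zt) l' (x : R) : ev i.1 <= x <= ev i.2 ->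
    exists2 k, k \in steps i.1 (cuts i l') & ev k.1 <= x <= ev k.2.
  move=> ix; apply: steps_cover; first by rewrite /cuts last_rcons.
  by rewrite /cuts; case: (sort _ _).
have [i ii qi] := cover _ (map fst l) _ qx; have [j ij qj] := cover _ (map snd l) _ qy.
have /allP/(_ _ ii)/allP/(_ _ ij)/hasP[s sl ijs] := h.
have := in_zsub_rect ijs (conj qi qj); move: sl => /flatten_mapP[c cp sc] sq.
exists (shift_tile (zpt_inv o) c); first by rewrite map_f.
exists (shift_rect (zpt_inv o) s); first by rewrite rects_shift map_f.
move: sq; rewrite /in_rect /= !evD !ev_zmul_inv !mulrBr => -[/andP[? ?] /andP[? ?]].
by split; apply/andP; split; lra.
Qed.

(** Holes count as pieces here, so the patch fills a whole rectangle: [child_rect] keeps the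
    children inside the inflated parents, [region_children] makes them cover these. *)
Lemma patch_region n q :
  (exists2 z, z \in tile_patch n & region z q) <->
  `|q.1| <= (1 + tau) ^+ n * tau /\ `|q.2| <= (1 + tau) ^+ n * (1 - tau).
Proof.
have i0 := itau_gt0.
elim: n q => [|n IH] q.
  rewrite !expr0 !mul1r !ler_norml.
  split=> [[z]|[h1 h2]].
    by rewrite inE => /eqP -> /hole_region; apply.
  exists (((true, false), (false, false)), (z0, z0)); first by rewrite inE.
  exists ((z0 - zT, z0 + zT), (z0 - zT2, z0 + zT2)); first by [].
  by rewrite /in_rect /= !evD !evN ev_z0 ev_zT ev_zT2 !add0r.
pose q0 : plane R := (q.1 / (1 + tau), q.2 / (1 + tau)).
have qE : q = inflate q0.
  by rewrite /inflate /= ![_ * (_ / _)]mulrC !divfK ?gt_eqF// -surjective_pairing.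
have -> : (`|q.1| <= (1 + tau) ^+ n.+1 * tau /\ `|q.2| <= (1 + tau) ^+ n.+1 * (1 - tau)) <->
    (`|q0.1| <= (1 + tau) ^+ n * tau /\ `|q0.2| <= (1 + tau) ^+ n * (1 - tau)).
  by rewrite qE /= !normrM (gtr0_norm i0) exprS -!mulrA !(ler_pM2l i0).
rewrite -IH; split=> [[z] | [z zn zq0]] /=.
  move=> /flatten_mapP[y yn zy] [r rz rq]; have [r' ry rr] := child_rect zy rz.
  by exists y => //; exists r' => //; apply/in_zscale_rect; rewrite -qE; exact: in_zsub_rect rq.
have [c cz cq] := region_children zq0; exists c; last by rewrite qE.
by apply/flatten_mapP; exists z.
Qed.

End Patch.

(** * The tilings of a rectangle with a hole *)

Section Realize.
Variable R : realType.
Local Notation psi := (psi R).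
Local Notation tau := (tau R).
Local Notation ev := (@zeval R).
Local Notation evp := (@zeval_pt R).
Local Notation bee := (@bee R).

Definition sgb (b : bool) : R := if b then -1 else 1.

Definition phi (q : plane R) : plane R := (psi * q.1, q.2).

Definition is_hole (z : placed) : bool := z.1.1.1.
Definition is_small (z : placed) : bool := z.1.1.2.

(** Exchanging the axes of a small tile brings its vertices back to abscissas in [psi] Z[tau] and
    ordinates in Z[tau]. *)
Definition tile_map (z : placed) (p : plane R) : plane R :=
  let: (x, y) := if is_small z then (psi * p.2, psi * p.1) else p in
  (psi * ev z.2.1 + sgb z.1.2.1 * x, ev z.2.2 + sgb z.1.2.2 * y).

Definition tile_ratio (z : placed) : R := if is_small z then psi else 1.

Definition tile (z : placed) : set (plane R) := tile_map z @` bee.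

Lemma tile_similarity z : similarity (tile_ratio z) (tile_map z).
Proof.
have s0 := @psi_gt0 R.
have sg b : sgb b ^+ 2 = 1 by rewrite /sgb; case: b; rewrite ?sqrrN expr1n.
apply: sqd_similarity; rewrite /tile_ratio /tile_map; first by case: ifP.
move=> [x y] [x' y']; rewrite /sqd; case: ifP => _ /=.
  transitivity (sgb z.1.2.1 ^+ 2 * (psi * (y - y')) ^+ 2 + sgb z.1.2.2 ^+ 2 * (psi * (x - x')) ^+ 2).
    by ring.
  by rewrite !sg; ring.
transitivity (sgb z.1.2.1 ^+ 2 * (x - x') ^+ 2 + sgb z.1.2.2 ^+ 2 * (y - y') ^+ 2); first by ring.
by rewrite !sg; ring.
Qed.

Lemma in_rect_place f o r (q : plane R) : in_rect (zrect_place f o r) q <->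
  in_rect r (sgb f.1 * (q.1 - ev o.1), sgb f.2 * (q.2 - ev o.2)).
Proof.
have itv b (w : zt) (i : zt * zt) x : (ev (zitv_place b w i).1 <= x <= ev (zitv_place b w i).2) =
    (ev i.1 <= sgb b * (x - ev w) <= ev i.2).
  rewrite /zitv_place /sgb; case: b => /=; rewrite !evD ?evN.
    by apply/andP/andP => -[? ?]; split; lra.
  by apply/andP/andP => -[? ?]; split; lra.
by rewrite /in_rect /= !itv.
Qed.

Definition base_region (k : kind) : set (plane R) :=
  [set q | exists2 r, r \in base_rects k & in_rect r q].

Lemma region_place z (q : plane R) : region z q <->
  base_region z.1.1 (sgb z.1.2.1 * (q.1 - ev z.2.1), sgb z.1.2.2 * (q.2 - ev z.2.2)).
Proof.
split=> [[r]|[r rz rq]].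
  by move=> /mapP[r0 r0z ->] /in_rect_place; exists r0.
by exists (zrect_place z.1.2 z.2 r); [exact: map_f|exact/in_rect_place].
Qed.

Lemma base_regionL (q : plane R) : base_region (false, false) q <->
  (0 <= q.1 <= 1 /\ 0 <= q.2 <= tau) \/ (0 <= q.1 <= tau /\ 0 <= q.2 <= 1).
Proof.
rewrite -(ev_z0 R) -(ev_z1 R) -[tau](ev_zT R); split=> [[r]|[h|h]].
- by rewrite !inE => /orP[]/eqP-> ?; [left|right].
- by exists ((z0, z1), (z0, zT)).
- by exists ((z0, zT), (z0, z1)).
Qed.

Lemma base_regionS (q : plane R) : base_region (false, true) q <->
  (0 <= q.1 <= tau /\ 0 <= q.2 <= tau) \/ (0 <= q.1 <= 1 /\ 0 <= q.2 <= 1 - tau).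
Proof.
rewrite -(ev_zT2 R) -(ev_z0 R) -(ev_z1 R) -[tau](ev_zT R); split=> [[r]|[h|h]].
- by rewrite !inE => /orP[]/eqP-> ?; [left|right].
- by exists ((z0, zT), (z0, zT)).
- by exists ((z0, z1), (z0, zT2)).
Qed.

Lemma tileP z (q : plane R) : ~~ is_hole z -> tile z q <-> region z (q.1 / psi, q.2).
Proof.
have s0 := @psi_gt0 R; have s0' : psi != 0 by rewrite gt_eqF.
have tt := @tau_sqr R; have ss := @psi_sqr R.
case: z => [[[[] s] f] o] // _; rewrite region_place /=.
have inv (p : plane R) : tile_map (((false, s), f), o) p = q <->
    (sgb f.1 * (q.1 / psi - ev o.1), sgb f.2 * (q.2 - ev o.2)) =
    (if s then (p.2, psi * p.1) else (p.1 / psi, p.2)).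
  rewrite /tile_map /is_small /=.
  have e1 (a b c x : R) : b ^+ 2 = 1 -> psi * a + b * (psi * c) = x <-> b * (x / psi - a) = c.
    move=> b2; split=> [<-|<-].
      transitivity (b ^+ 2 * c); last by rewrite b2 mul1r.
      by field.
    transitivity (psi * a + b ^+ 2 * (x - psi * a)); last by rewrite b2; ring.
    by field.
  have e2 (a b c x : R) : b ^+ 2 = 1 -> a + b * c = x <-> b * (x - a) = c.
    move=> b2; split=> [<-|<-].
      transitivity (b ^+ 2 * c); last by rewrite b2 mul1r.
      by ring.
    transitivity (a + b ^+ 2 * (x - a)); last by rewrite b2; ring.
    by ring.
  have sg b : sgb b ^+ 2 = 1 by rewrite /sgb; case: b; rewrite ?sqrrN expr1n.
  case: s; case: p => x y; case: q => u w /=.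
    by split=> -[] /(e1 _ _ _ _ (sg _)) -> /(e2 _ _ _ _ (sg _)) ->.
  have xE : x = psi * (x / psi) by field.
  by split=> -[]; [rewrite {1}xE|rewrite [in X in _ -> _ -> X]xE];
    move=> /(e1 _ _ _ _ (sg _)) -> /(e2 _ _ _ _ (sg _)) ->.
split=> [[p bp /inv ->]|].
  move/beeP: bp; case: s inv => inv /=; [rewrite base_regionS|rewrite base_regionL] => /=.
    by move=> [[/andP[? ?] /andP[? ?]]|[/andP[? ?] /andP[? ?]]]; [left|right]; split;
      apply/andP; split => //; nra.
  rewrite !ler_pdivlMr // !ler_pdivrMr // !mul0r !mul1r [tau * _]mulrC.
  by case; [left|right].
set w1 := sgb _ * _; set w2 := sgb _ * _.
move=> bw; exists (if s then (w2 / psi, w1) else (psi * w1, w2)); last first.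
  by apply/inv; case: s {inv bw} => /=; [rewrite [psi * _]mulrC divfK|rewrite [psi * _]mulrC mulfK].
case: s {inv} bw => /=; [rewrite base_regionS|rewrite base_regionL]; rewrite beeP /=.
  rewrite !ler_pdivlMr // !ler_pdivrMr // !mul0r => h.
  case: h => -[/andP[? ?] /andP[? ?]]; [left|right]; split; apply/andP; split => //; nra.
by case=> -[/andP[? ?] /andP[? ?]]; [left|right]; split; apply/andP; split => //; nra.
Qed.

End Realize.

(** * Arrows of the placed tiles *)

Section Arrows.
Variable R : realType.
Local Notation psi := (psi R).
Local Notation tau := (tau R).
Local Notation ev := (@zeval R).
Local Notation evp := (@zeval_pt R).
Local Notation bee := (@bee R).
Local Notation tile := (@tile R).

Definition real_arrow (a : zarrow) : arrow R := (phi (evp a.1.1), phi (evp a.1.2), a.2).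

Definition bee_point (s : bool) (p : zpt) : plane R :=
  if s then (ev p.2 / psi, ev p.1) else (psi * ev p.1, ev p.2).
Definition bee_arrow (s : bool) (a : zarrow) : arrow R :=
  (bee_point s a.1.1, bee_point s a.1.2, a.2).

Lemma large_arrowsE : large_arrows R = map (bee_arrow false) (base_arrows (false, false)).
Proof.
rewrite /= /bee_arrow /bee_point /= !evD !(ev_z0, ev_z1, ev_zT, ev_zT2) mulr0 mulr1 -psi3 -psi4.
by rewrite /large_arrows [2 * _]mulr_natl mulr2n.
Qed.

Lemma small_arrowsE : small_arrows R = map (bee_arrow true) (base_arrows (false, true)).
Proof.
have s0 : psi != 0 by rewrite gt_eqF // psi_gt0.
rewrite /= /bee_arrow /bee_point /= !(ev_z0, ev_z1, ev_zT, ev_zT2) mul0r -psi4.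
have -> : tau / psi = psi by rewrite -psi_sqr expr2 mulfK.
by have -> : psi ^+ 4 / psi = psi ^+ 3 by rewrite exprSr mulfK.
Qed.

Lemma tile_map_bee_point (z : placed) p : ~~ is_hole z ->
  tile_map z (bee_point (is_small z) p) = phi (evp (zpt_place z.1.2 z.2 p)).
Proof.
have s0 : psi != 0 by rewrite gt_eqF // psi_gt0.
move=> _; rewrite /tile_map /bee_point /phi /zeval_pt /zpt_place /zpt_flip /= !evD.
have evs b x : ev (zsg b x) = sgb R b * ev x.
  by rewrite /zsg /sgb; case: b; rewrite ?evN ?mulN1r ?mul1r.
rewrite !evs; case: (is_small z) => /=; congr (_, _).
- by ring.
- by rewrite [psi * (_ / _)]mulrC divfK.
- by ring.
Qed.

Lemma map_arrow_tile (z : placed) : ~~ is_hole z ->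
  map (map_arrow (tile_map z)) (if is_small z then small_arrows R else large_arrows R) =
  map real_arrow (arrows z).
Proof.
move=> hz; have : (if is_small z then small_arrows R else large_arrows R) =
    map (bee_arrow (is_small z)) (base_arrows z.1.1).
  move: hz; rewrite /is_hole /is_small; case: z => [[[[] []] f] o] //= _.
    exact: small_arrowsE.
  exact: large_arrowsE.
move=> ->; rewrite -!map_comp; apply: eq_map => a /=.
by rewrite /map_arrow /real_arrow /= !tile_map_bee_point.
Qed.

(** [tile_arrow] admits any similarity onto the tile: the ratio tells large from small, and
    [image_bee_inj] then leaves only [tile_map z]. *)
Lemma tile_arrowP (z : placed) e : ~~ is_hole z -> tile_arrow 1 (tile z) e ->
  exists2 a, a \in arrows z & e = real_arrow a.
Proof.
move=> hz; have zs := @tile_similarity R z.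
have psi_neq1 : psi <> 1 by have := @psi_lt1 R => + h; rewrite h ltxx.
have conclude l f : similarity (tile_ratio R z) f -> tile z = f @` bee ->
    l = (if is_small z then small_arrows R else large_arrows R) ->
    e \in map (map_arrow f) l -> exists2 a, a \in arrows z & e = real_arrow a.
  move=> fs zf ->; rewrite -(image_bee_inj zs fs zf) map_arrow_tile //.
  by move=> /mapP[a az ->]; exists a.
case=> -[f [fs zf ef]].
  have r1 := image_bee_ratio zs fs zf.
  apply: (conclude (large_arrows R) f) => //; first by rewrite r1.
  by move: r1; rewrite /tile_ratio; case: ifP.
rewrite mulr1 in fs; have r1 := image_bee_ratio zs fs zf.
apply: (conclude (small_arrows R) f) => //; first by rewrite r1.
by move: r1; rewrite /tile_ratio; case: ifP => // _ /esym.
Qed.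

Lemma segment_phi P Q (p : plane R) : segment (phi P) (phi Q) p ->
  exists2 q, segment P Q q & p = phi q.
Proof.
move=> /segmentP[s [s01 e1 e2]].
exists (P.1 + s * (Q.1 - P.1), P.2 + s * (Q.2 - P.2)); first by apply/segmentP; exists s.
by rewrite [p]surjective_pairing e1 e2 /phi /=; congr (_, _); ring.
Qed.

Lemma phi_inj : injective (@phi R).
Proof.
by move=> [x y] [x' y'] [/(mulfI (lt0r_neq0 (psi_gt0 R))) -> ->].
Qed.

Lemma compatible_arrows (z z' : placed) e e' : ~~ is_hole z -> ~~ is_hole z' ->
  compatible R z z' -> tile_arrow 1 (tile z) e -> tile_arrow 1 (tile z') e' ->
  (exists x y, [/\ x <> y, (segment e.1.1 e.1.2 `&` segment e'.1.1 e'.1.2) x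
    & (segment e.1.1 e.1.2 `&` segment e'.1.1 e'.1.2) y]) -> e = e'.
Proof.
move=> hz hz' [_ comp] /(tile_arrowP hz)[a az ->] /(tile_arrowP hz')[b bz ->].
move=> [x [y [xy [/= ax bx] [/= ay by_]]]].
have [-> //|ab] := comp _ _ az bz; exfalso; apply: xy.
move: ax bx ay by_ => /segment_phi[p ap ->] /segment_phi[p' bp /phi_inj pp].
move=> /segment_phi[q aq ->] /segment_phi[q' bq /phi_inj qq].
by rewrite (ab p q) // ?pp ?qq // -?pp -?qq.
Qed.

Lemma avoid_seq (s : seq R) x e : 0 < e -> exists2 y, x < y < x + e & y \notin s.
Proof.
elim: s e => [|a s IH] e e0; first by exists (x + e / 2) => //; apply/andP; split; lra.
have [ax|xa] := leP a x.
  have [y /andP[xy ye] ys] := IH _ e0; exists y; first exact/andP.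
  by rewrite inE negb_or ys andbT; apply: contraTneq xy => ->; rewrite -leNgt.
have [|y /andP[xy ye] ys] := IH (Num.min e (a - x)); first by rewrite lt_min e0 subr_gt0.
have : y < x + e /\ y < a by move: ye; rewrite minElt; case: ifP => + ?; split; lra.
move=> [ye' ya]; exists y; first exact/andP.
by rewrite inE negb_or ys andbT (lt_eqF ya).
Qed.

(** Slightly up and to the right of a common interior point there is a common point on none of the
    finitely many lines through right and top sides. Separated rectangles can share only points on
    such a side. *)
Lemma compatible_interior (z z' : placed) : ~~ is_hole z -> ~~ is_hole z' ->
  compatible R z z' -> ~ ((interior (tile z) `&` interior (tile z')) !=set0).
Proof.
move=> hz hz' [comp _] [q [qz qz']].
have s0 := psi_gt0 R.
have : nbhs q (tile z `&` tile z') by apply: filterI.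
move=> /nbhs_ballP[e /= e0 qe].
pose l := rects z ++ rects z'.
have [x /andP[x1 x2] xl] := avoid_seq [seq psi * ev r.1.2 | r <- l] q.1 e0.
have [y /andP[y1 y2] yl] := avoid_seq [seq ev r.2.2 | r <- l] q.2 e0.
have : ball q e (x, y).
  by split; rewrite /ball /= ltr_distlC; apply/andP; split; lra.
move=> /qe[/(tileP _ hz)[r rz [/= rx ry]] /(tileP _ hz')[r' rz' [/= rx' ry']]].
have xr t : t \in l -> x / psi != ev t.1.2.
  move=> tl; apply: contraNneq xl => h; apply/mapP; exists t => //.
  by rewrite -h mulrC divfK // gt_eqF.
have yr t : t \in l -> y != ev t.2.2.
  by move=> tl; apply: contraNneq yl => h; apply/mapP; exists t.
have rl : r \in l by rewrite mem_cat rz.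
have rl' : r' \in l by rewrite mem_cat rz' orbT.
move: rx ry rx' ry' (xr _ rl) (yr _ rl) (xr _ rl') (yr _ rl').
move=> /andP[? ?] /andP[? ?] /andP[? ?] /andP[? ?].
rewrite !neq_lt => h1 h2 h3 h4.
have {}h1 : x / psi < ev r.1.2 by case/orP: h1 => //; lra.
have {}h2 : y < ev r.2.2 by case/orP: h2 => //; lra.
have {}h3 : x / psi < ev r'.1.2 by case/orP: h3 => //; lra.
have {}h4 : y < ev r'.2.2 by case/orP: h4 => //; lra.
by case: (comp _ _ rz rz'); lra.
Qed.

Definition holed_tiling (n : nat) : set (set (plane R)) :=
  [set A | exists z, [/\ z \in tile_patch n, ~~ is_hole z & A = tile z]].

Lemma holed_tiling_A2 n : holed_tiling n !=set0 -> d_tiling 1 (holed_tiling n) /\ arrow_rule 1 (holed_tiling n).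
Proof.
move=> ne; split.
  split=> //.
    move=> _ [z [_ _ ->]]; have := @tile_similarity R z.
    rewrite /tile_ratio; case: ifP => _ zs; [right|left].
      by exists (tile_map z) => //; rewrite mulr1.
    by exists (tile_map z).
  move=> _ _ [z [zn hz ->]] [z' [zn' hz' ->]] ne'.
  have [-> //|zz'] := pselect (z = z').
  by case: (compatible_interior hz hz' (patch_compatible R zn zn' zz')).
move=> _ _ [z [zn hz ->]] [z' [zn' hz' ->]] ne' e e' ze ze'.
have [zz'|zz'] := pselect (z = z'); first by case: ne'; rewrite zz'.
exact: (compatible_arrows hz hz' (patch_compatible R zn zn' zz')).
Qed.

End Arrows.

(** * The hole cannot be filled *)

Section Modulo5.
Variable R : realType.
Local Notation tau := (tau R).
Local Notation ev := (@zeval R).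

(** Modulo 5 this is the ring homomorphism from Z[tau] to F_5 sending [tau] to 2, the double root of
    X^2 + X - 1; its kernel is generated by [2 - tau]. *)
Definition residue (z : zt) : int := z.1 + 2 * z.2.

Lemma dvd5_sqr (a : int) : (5 %| a ^+ 2)%Z -> (5 %| a)%Z.
Proof. by rewrite !dvdzE abszX Euclid_dvdX // => /andP[]. Qed.

(* On Z[tau] the norm a^2 - ab - b^2 is congruent to the square of the residue. *)
Lemma ev0_residue z : ev z = 0 -> (5 %| residue z)%Z.
Proof.
case: z => a b; rewrite /zeval /residue /= => e.
apply: dvd5_sqr.
have n0 : a ^+ 2 - a * b - b ^+ 2 = 0.
  apply: (@intr_inj R); rewrite !rmorphB !rmorphXn !rmorphM /= rmorph0.
  have tt := @tau_sqr R.
  have -> : a%:~R ^+ 2 - a%:~R * b%:~R - b%:~R ^+ 2 =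
    (a%:~R + b%:~R * tau) * (a%:~R - b%:~R - b%:~R * tau) + b%:~R ^+ 2 * (tau ^+ 2 - (1 - tau)) :> R.
    by ring.
  by rewrite e tt; ring.
have -> : (a + 2 * b) ^+ 2 = 5 * (a * b + b ^+ 2).
  by rewrite -[LHS]subr0 -n0; ring.
exact: dvdz_mulr.
Qed.

(** This allows equalities between real numbers to be tested modulo 5. *)
Lemma ev_eq_residue x y : ev x = ev y -> (5 %| residue x)%Z = (5 %| residue y)%Z.
Proof.
move=> xy; have : ev (x - y) = 0 by rewrite evD evN xy subrr.
move=> /ev0_residue h.
have -> : residue x = residue (x - y) + residue y by rewrite /residue /=; ring.
by rewrite rpredDl.
Qed.

Lemma residue_zmul_inv x : (5 %| residue (zmul_inv x))%Z = (5 %| residue x)%Z.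
Proof.
case: x => a b; rewrite /residue /=.
have -> : a + b + 2 * a = 3 * (a + 2 * b) - 5 * b by ring.
by rewrite rpredBr; [rewrite Gauss_dvdzr|exact: dvdz_mulr].
Qed.

Lemma residue_zmul_tau x : (5 %| residue (zmul_tau x))%Z = (5 %| residue x)%Z.
Proof.
case: x => a b; rewrite /residue /=.
have -> : b + 2 * (a - b) = 2 * (a + 2 * b) - 5 * b by ring.
by rewrite rpredBr; [rewrite Gauss_dvdzr|exact: dvdz_mulr].
Qed.

(** [4 * (1 - tau)] has residue -4, and modulo 5 the units [1 + tau] and [tau] multiply residues by
    3 and 2; the factor [2 - tau] makes the residue of [y] equal to [5 * n]. *)
Lemma not_multiple (k m n : nat) (c : R) : c = 1 \/ c = tau \/ c = 1 + tau ->
  4 * (1 - tau) * (1 + tau) ^+ k <> c * ((2 - tau) * (m%:R + n%:R * tau)).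
Proof.
have tt := @tau_sqr R.
pose x := iter k zmul_inv (4, - 4); pose y : zt := (2 * m%:Z - n%:Z, 3 * n%:Z - m%:Z).
have xE : ev x = 4 * (1 - tau) * (1 + tau) ^+ k.
  rewrite /x; elim: k {x} => [|k IH] /=.
    by rewrite /zeval /= expr0 rmorphN /= rmorph_nat; ring.
  by rewrite ev_zmul_inv IH exprS; ring.
have yE : ev y = (2 - tau) * (m%:R + n%:R * tau).
  rewrite /zeval /y /= !rmorphB !rmorphM /= !rmorph_nat -!pmulrn.
  transitivity ((2 - tau) * (m%:R + n%:R * tau) + n%:R * (tau ^+ 2 - (1 - tau))); first by ring.
  by rewrite tt; ring.
have rx : (5 %| residue x)%Z = false.
  by rewrite /x; elim: k {x xE} => [|k IH] //=; rewrite residue_zmul_inv.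
have ry : (5 %| residue y)%Z.
  rewrite /residue /y /=; have -> : 2 * m%:Z - n%:Z + 2 * (3 * n%:Z - m%:Z) = 5 * n%:Z by ring.
  exact: dvdz_mulr.
rewrite -xE -yE => cE h.
have contra w : ev x = ev w -> (5 %| residue w)%Z -> False by move=> /ev_eq_residue <-; rewrite rx.
case: cE h => [->|[->|->]].
- by rewrite mul1r => /contra; apply.
- by rewrite -ev_zmul_tau => /contra; apply; rewrite residue_zmul_tau.
- by rewrite -ev_zmul_inv => /contra; apply; rewrite residue_zmul_inv.
Qed.

End Modulo5.

(** * Rectangle, scale and comparison of areas *)

Section Main.
Variable R : realType.
Local Notation psi := (psi R).
Local Notation tau := (tau R).
Local Notation mplane := (measurableTypeR R * measurableTypeR R)%type.

Definition box (a b : R) : set (plane R) := [set q | `|q.1| <= a /\ `|q.2| <= b].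

Lemma area_box a b : 0 < a -> 0 < b ->
  measurable (box a b : set mplane) /\ plane_area (box a b) = (4 * (a * b))%:E.
Proof.
move=> a0 b0; have n1 : (1 : R) != 0 by rewrite oner_eq0.
have aa : - a < a by lra.
have bb : - b < b by lra.
have [mA aA] := area_scaled_rect true false true false n1 n1 aa bb.
have -> : box a b = [set z : mplane | 1 * z.1 \in itvB true (- a) false a /\ 1 * z.2 \in itvB true (- b) false b].
  by apply/seteqP; split => -[x y]; rewrite /box /= !mul1r !in_itv /= !ler_norml.
by split=> //; rewrite aA normr1 mulr1 divr1; congr (_%:E); ring.
Qed.

Lemma growth_ge n : n%:R / 2 <= (1 + tau) ^+ n.
Proof.
have /andP[t1 t2] := @tau_bounds R.
elim: n => [|n IH]; first by rewrite mul0r expr0.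
have : 1 <= (1 + tau) ^+ n by apply: exprn_ege1; lra.
by rewrite exprS -natr1; nra.
Qed.

Lemma exists_growth (M : R) : exists n, M <= (1 + tau) ^+ n.
Proof.
exists (Num.truncn (2 * M)).+1; apply: le_trans (growth_ge _).
by have := truncnS_gt (2 * M); lra.
Qed.

Lemma squareP n (q : plane R) : @square R n q <-> `|q.1| <= n%:R /\ `|q.2| <= n%:R.
Proof. by rewrite /square /= !in_itv /= !ler_norml. Qed.

Lemma holed_tiling_sub n :
  \bigcup_(A in @holed_tiling R n) A `<=`
  box (psi * ((1 + tau) ^+ n * tau)) ((1 + tau) ^+ n * (1 - tau)).
Proof.
move=> q [_ [z [zn hz ->]] /(tileP _ hz) zq].
have s0 := @psi_gt0 R.
have /(patch_region n) [/=] : exists2 z, z \in tile_patch n & region z (q.1 / psi, q.2) by exists z.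
by rewrite normrM normfV (gtr0_norm s0) ler_pdivrMr // [_ * psi]mulrC.
Qed.

(** A point of the patch in no tile is in a hole, which is centred at the origin with half-sides at
    most [psi * tau] and [1 - tau], both below 1. *)
Lemma box_sub_holed_tiling n :
  box (psi * ((1 + tau) ^+ n * tau)) ((1 + tau) ^+ n * (1 - tau)) `\` @square R 1 `<=`
  \bigcup_(A in @holed_tiling R n) A.
Proof.
have s0 := @psi_gt0 R; have s1 := @psi_lt1 R; have /andP[t1 t2] := @tau_bounds R.
move=> q [[q1 q2] nq].
have /(patch_region n) [z zn zq] : `|(q.1 / psi, q.2).1| <= (1 + tau) ^+ n * tau /\
    `|(q.1 / psi, q.2).2| <= (1 + tau) ^+ n * (1 - tau).
  by rewrite /= normrM normfV (gtr0_norm s0) ler_pdivrMr // [_ * psi]mulrC.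
have [hz|hz] := boolP (is_hole z); last by exists (@tile R z); [exists z|exact/tileP].
exfalso; apply: nq; apply/squareP.
have [/= + +] := hole_region hz (patch_hole zn hz) zq.
rewrite ler_pdivlMr // ler_pdivrMr // !ler_norml => /andP[? ?] /andP[? ?].
by split; apply/andP; split; nra.
Qed.

(* A tile meeting the corner of the box is far from the centre. *)
Lemma far_tile n (c : nat) : (0 < c)%N -> c%:R + 1 <= (1 + tau) ^+ n * (1 - tau) ->
  exists2 A, @holed_tiling R n A & A `<=` ~` @square R c.
Proof.
have s0 := @psi_gt0 R; have s1 := @psi_lt1 R; have /andP[t1 t2] := @tau_bounds R.
have ts : tau <= psi by rewrite -psi_sqr; nra.
rewrite -(ler1n R) => c1; set s := (1 + tau) ^+ n => cs.
have s_ge0 : 0 <= s by rewrite exprn_ge0 //; lra.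
have [q qE] : exists q : plane R, q = (psi * (s * tau), s * (1 - tau)) by eexists.
have sp : s * (1 - tau) <= psi * (s * tau).
  rewrite [leRHS]mulrCA ler_wpM2l //.
  by have := @tau_sqr R; nra.
have [] : (\bigcup_(A in @holed_tiling R n) A) q.
  apply: box_sub_holed_tiling; rewrite -/s qE; split.
    by split; rewrite /= ger0_norm //; lra.
  by move=> /squareP[_] /=; rewrite ger0_norm; lra.
move=> _ [z [zn hz ->]] zq; exists (tile z); first by exists z.
move=> w zw /squareP[+ _]; rewrite ler_norml => /andP[_ wc].
(* A tile is at most [psi < 1] wide, so the one at the corner, whose abscissa is at least [c + 1],
   cannot reach abscissa [c]. *)
have unit_x (p : plane R) : region z p -> 0 <= sgb R z.1.2.1 * (p.1 - zeval R z.2.1) <= 1.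
  move=> /region_place; move: hz; rewrite /is_hole; case: z.1.1 => -[] [] //= _.
    by move=> /base_regionS /= [] [/andP[? ?] _]; apply/andP; split => //; lra.
  by move=> /base_regionL /= [] [/andP[? ?] _]; apply/andP; split => //; lra.
move: zq zw => /(tileP _ hz)/unit_x /= /andP[h1 h2] /(tileP _ hz)/unit_x /= /andP[h3 h4].
have : q.1 / psi - w.1 / psi <= 1.
  by move: h1 h2 h3 h4; rewrite /sgb /=; case: z.1.2.1 => *; lra.
rewrite -mulrBl ler_pdivrMr // mul1r qE /=.
by lra.
Qed.

(** Sizes being determined by tiles, [s] is [d] or [psi * d], so [d] is 1, [psi] or the inverse of
    [psi], whose square is [1 + tau]. *)
Lemma tiling_scale (d s : R) (A : set (plane R)) : (s = 1 \/ s = psi) -> is_tile s A ->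
  large_tile d A \/ small_tile d A -> [\/ d ^+ 2 = 1, d ^+ 2 = tau | d ^+ 2 = 1 + tau].
Proof.
have s0 := @psi_gt0 R.
have ratio r f : is_tile s A -> similarity r f -> A = f @` @bee R -> s = r.
  by move=> [g gs gA] fs fA; apply: (image_bee_ratio gs fs); rewrite -gA.
move=> s1 sA [[f fs fA]|[f fs fA]]; have e := ratio _ _ sA fs fA.
  by case: s1 => s1; rewrite -e s1; [apply: Or31; rewrite expr1n|apply: Or32].
case: s1 => s1; rewrite s1 in e; last first.
  by apply: Or31; rewrite (mulfI (lt0r_neq0 s0) (_ : psi * d = psi * 1)) ?expr1n // mulr1.
apply: Or33; have ts : tau * d ^+ 2 = 1 by rewrite -psi_sqr -exprMn -e expr1n.
have tau0 : tau != 0 by rewrite -psi_sqr expf_eq0 /= gt_eqF.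
apply: (mulfI tau0); rewrite ts mulrDr mulr1 -expr2 tau_sqr; ring.
Qed.

End Main.

Theorem corollary2 (R : realType) (c1 c2 : nat) :
  (0 < c1)%N -> (c1 < c2)%N -> ~ robust c1 c2 (@A2_tiling R).
Proof.
move=> c1_gt0 c12 rob.
have c2_gt0 : (0 < c2)%N by exact: leq_ltn_trans c12.
have s0 := @psi_gt0 R; have /andP[t1 t2] := @tau_bounds R.
have ts : 1 - tau R <= psi R * tau R.
  have ps : tau R <= psi R by have := @psi_sqr R; have := @psi_lt1 R; nra.
  by have := @tau_sqr R; nra.
(* The box must exceed the square of half-side [c2] by a margin of 1, which leaves room for a tile
   disjoint from that square. *)
have [n nP] := exists_growth ((c2%:R + 1) / (1 - tau R)).
have {}nP : c2%:R + 1 <= (1 + tau R) ^+ n * (1 - tau R).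
  by move: nP; rewrite ler_pdivrMr //; lra.
have c2_ge1 : 1 <= c2%:R :> R by rewrite ler1n.
pose a := psi R * ((1 + tau R) ^+ n * tau R); pose b := (1 + tau R) ^+ n * (1 - tau R).
have ba : b <= a.
  rewrite /a /b [leRHS]mulrCA ler_wpM2l // exprn_ge0 //; lra.
have b_gt0 : 0 < b by rewrite /b; lra.
have square_box m : (m <= c2)%N -> @square R m `<=` box a b.
  rewrite -(ler_nat R) => mc q /squareP[q1 q2]; split.
    by apply: (le_trans q1); apply: le_trans ba; rewrite /b; lra.
  by apply: (le_trans q2); rewrite /b; lra.
have [B TB Bfar] := far_tile c2_gt0 nP.
have A2T : A2_tiling (@holed_tiling R n).
  by exists 1; apply: holed_tiling_A2; exists B.
(* With [Delta] equal to 1 the central square contains the hole, so the repaired tiling tiles the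
   full box. *)
have [|T' [A2T' tT' keep]] := rob 1%N isT (@holed_tiling R n) _ A2T erefl.
  rewrite muln1 => q [qc q1]; apply: box_sub_holed_tiling; split => //.
  exact: (square_box c2).
have {}tT' : tiles T' (box a b).
  rewrite /tiles tT'; apply/seteqP; split => q.
    by move=> [/holed_tiling_sub //|]; exact: square_box.
  by move=> qX; have [?|q1] := pselect (@square R 1 q); [right|left; exact: box_sub_holed_tiling].
have T'B : T' B.
  apply: keep => // w Bw wc; apply: (Bfar _ Bw); move: wc => /squareP[w1 w2].
  have cc : c1%:R <= c2%:R :> R by rewrite ler_nat ltnW.
  by rewrite muln1 in w1 w2; apply/squareP; split; [exact: le_trans cc|exact: le_trans cc].
have [d [dT' _]] := A2T'.
have [mX aX] := area_box (lt_le_trans b_gt0 ba) b_gt0.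
have [m [k e]] := tiling_area dT' tT' mX aX.
have [_ _ /(_ _ T'B) Bd _] := dT'.
have [z [_ hz BE]] := TB.
have : [\/ d ^+ 2 = 1, d ^+ 2 = tau R | d ^+ 2 = 1 + tau R].
  apply: (@tiling_scale R d (tile_ratio R z) B) => //.
    by rewrite /tile_ratio; case: ifP; [right|left].
  by exists (tile_map z) => //; exact: tile_similarity.
(* Both [4 * (a * b)] and [bee_area] contain the factor [psi * tau]; cancelling it leaves an
   identity within Z[tau]. *)
move=> d2; apply: (@not_multiple R (n + n) m k (d ^+ 2)).
  by case: d2 => ->; [left|right; left|right; right].
have st0 : psi R * tau R != 0 by rewrite mulf_neq0 // gt_eqF //; lra.
apply: (mulfI st0); transitivity (4 * (a * b)); first by rewrite /a /b exprD; ring.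
by rewrite e /bee_area; ring.
Qed.
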